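(* Let $A$ be an artinian local ring with infinite residue field, let $S$ be a finitely generated standard $\mathbb{N}^d$-graded algebra over $A$ and let $M$ be a finitely generated $\mathbb{N}^d$-graded $S$-module. Let $\mathbf{k}\in\mathbb{N}^d$ and let $\mathbf{x}$ be a mixed multiplicity system of $M$ of the type $\mathbf{k}$. Assume that $\dim \mathrm{Supp}_{++}M \le |\mathbf{k}|$. Then $$E(M;\mathbf{k})=\chi(\mathbf{x},M)=\widetilde{e}(\mathbf{x},M).$$
   Context: Notation: $\mathbf{e}_i=(0,\dots,1,\dots,0)\in\mathbb{N}^d$ (1 in position $i$), $\mathbf 0=(0,\dots,0)$, $\mathbf 1=(1,\dots,1)$, $|\mathbf k|=k_1+\dots+k_d$, $\mathbf k!=k_1!\cdots k_d!$, $\mathbf n^{\mathbf k}=n_1^{k_1}\cdots n_d^{k_d}$; ''for all large $\mathbf n$'' ($\mathbf n\gg 0$) means for all $\mathbf n\ge \mathbf v$ componentwise for some $\mathbf v$. ''Standard'' means $S_{\mathbf 0}=A$ and $S$ is generated as an $A$-algebra by $S_i:=S_{\mathbf e_i}$, $i=1,\dots,d$. Put $S_{++}=\bigoplus_{\mathbf n\ge\mathbf 1}S_{\mathbf n}$, $\mathrm{Proj}\,S$ = set of homogeneous primes of $S$ not containing $S_{++}$, and $\mathrm{Supp}_{++}M=\{P\in\mathrm{Proj}\,S: M_P\neq0\}$; its dimension is taken to be $-\infty$ if it is empty. For a finitely generated $\mathbb{N}^d$-graded $S$-module $F$ there is a polynomial $P_F(\mathbf n)$ (the Hilbert polynomial)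 with $\ell_A(F_{\mathbf n})=P_F(\mathbf n)$ for all large $\mathbf n$, and $\deg P_F=\dim\mathrm{Supp}_{++}F$ (zero polynomial has degree $-\infty$). If $s=\dim\mathrm{Supp}_{++}M\ge0$, the terms of total degree $s$ of $P_M$ are written $\sum_{|\mathbf k|=s}e(M;\mathbf k)\mathbf n^{\mathbf k}/\mathbf k!$; $e(M;\mathbf k)$ is the mixed multiplicity of $M$ of type $\mathbf k$. For $|\mathbf k|\ge\dim\mathrm{Supp}_{++}M$ set $E(M;\mathbf k)=e(M;\mathbf k)$ if $|\mathbf k|=\dim\mathrm{Supp}_{++}M$ and $E(M;\mathbf k)=0$ if $|\mathbf k|>\dim\mathrm{Supp}_{++}M$. A sequence $\mathbf x=x_1,\dots,x_n$ of elements of $\bigcup_{j=1}^dS_j$ consisting of $m_1$ elements of $S_1,\dots,m_d$ elements of $S_d$ is a mixed multiplicity system of $M$ of type $\mathbf m=(m_1,\dots,m_d)$ if $\dim\mathrm{Supp}_{++}(M/\mathbf xM)\le0$ (with $\mathbf xM=0$ if $\mathbf x$ is empty). For such $\mathbf x$, with $H_i(\mathbf x,M)$ the homology of the ($\mathbb N^d$-graded) Koszul complex of $M$ with respect to $\mathbf x$, the integer $\sum_{i=0}^n(-1)^i\ell_A(H_i(\mathbf x,M)_{\mathbf n})$ is constant for all large $\mathbf n$; this constant is the Euler–Poincaré characteristic $\chi(\mathbf x,M)$. The mixed multiplicity symbol $\widetilde e(\mathbf x,M)$ is defined recursively: if $n=0$, $\ell_A(M_{\mathbf n})=c$ is constant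 for large $\mathbf n$ and $\widetilde e(\emptyset,M)=c$; if $n>0$, $\widetilde e(\mathbf x,M)=\widetilde e(\mathbf x',M/x_1M)-\widetilde e(\mathbf x',0_M:x_1)$ where $\mathbf x'=x_2,\dots,x_n$ (which is a mixed multiplicity system of both $M/x_1M$ and $0_M:x_1$). *)

(* Defs.v *)
From HB Require Import structures.
From mathcomp Require Import all_boot all_order all_algebra.
From mathcomp Require Import mpoly.
Set Implicit Arguments. Unset Strict Implicit. Unset Printing Implicit Defensive.
Import GRing.Theory.
Local Open Scope ring_scope.

Definition strict_sub {T : Type} (P Q : T -> Prop) : Prop :=
  (forall v, P v -> Q v) /\ exists v, Q v /\ ~ P v.

Section BaseRing.
Variable A : comNzRingType.

Definition is_ideal (I : A -> Prop) : Prop :=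
  [/\ I 0, (forall a b, I a -> I b -> I (a + b)) & (forall c a, I a -> I (c * a))].

Definition maximal_ideal (I : A -> Prop) : Prop :=
  [/\ is_ideal I, ~ I 1 &
      forall J, is_ideal J -> (forall a, I a -> J a) -> ~ J 1 -> forall a, J a -> I a].

Definition local_ring : Prop :=
  exists m, maximal_ideal m /\ forall m', maximal_ideal m' -> forall a, m' a <-> m a.

Definition artinian_ring : Prop :=
  forall I : nat -> A -> Prop, (forall n, is_ideal (I n)) ->
    (forall n a, I n.+1 a -> I n a) ->
    exists N, forall n, (N <= n)%N -> forall a, I n a <-> I N a.

Definition infinite_residue_field : Prop :=
  forall m, maximal_ideal m -> forall s : seq A, exists a, forall x, x \in s -> ~ m (a - x).
End BaseRing.

Definition multideg (d : nat) := {ffun 'I_d -> nat}.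
Definition mdeg_add d (u v : multideg d) : multideg d := [ffun i => (u i + v i)%N].
Definition mdeg_sub d (u v : multideg d) : multideg d := [ffun i => (u i - v i)%N].
Definition mdeg0 d : multideg d := [ffun _ => 0%N].
Definition mdeg1 d : multideg d := [ffun _ => 1%N].
Definition unitdeg d (i : 'I_d) : multideg d := [ffun j => nat_of_bool (j == i)].
Definition mle d (u v : multideg d) : Prop := forall i, (u i <= v i)%N.
Definition mtot d (k : multideg d) : nat := (\sum_(i < d) k i)%N.
Definition mfact d (k : multideg d) : nat := (\prod_(i < d) (k i)`!)%N.

Definition direct_sum_dec (V : zmodType) d (G : multideg d -> V -> Prop) : Prop :=
  (forall v, exists ds : seq (multideg d), exists f : multideg d -> V,
      [/\ uniq ds, (forall n, n \in ds -> G n (f n)) & v = \sum_(n <- ds) f n]) /\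
  (forall (ds : seq (multideg d)) (f : multideg d -> V), uniq ds ->
      (forall n, n \in ds -> G n (f n)) -> \sum_(n <- ds) f n = 0 ->
      forall n, n \in ds -> f n = 0).

Section Graded.
Variables (A : comNzRingType) (S : comAlgType A) (d : nat).

Definition A_submod (V : lmodType S) (P : V -> Prop) : Prop :=
  [/\ P 0, (forall u v, P u -> P v -> P (u + v)) &
      (forall (a : A) v, P v -> P (a%:A *: v))].

Definition graded_algebra (Sg : multideg d -> S -> Prop) : Prop :=
  [/\ (forall n, [/\ Sg n 0, (forall s t, Sg n s -> Sg n t -> Sg n (s + t)) &
                     (forall (a : A) s, Sg n s -> Sg n (a%:A * s))]),
      (forall a b s t, Sg a s -> Sg b t -> Sg (mdeg_add a b) (s * t)),
      Sg (mdeg0 d) 1 &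
      direct_sum_dec Sg].

Definition generates_alg (G : S -> Prop) : Prop :=
  forall P : S -> Prop, (forall a : A, P a%:A) ->
    (forall s t, P s -> P t -> P (s + t)) -> (forall s t, P s -> P t -> P (s * t)) ->
    (forall s, G s -> P s) -> forall s, P s.

Definition fin_gen_algebra : Prop := exists gs : seq S, generates_alg (fun s => s \in gs).

Definition standard (Sg : multideg d -> S -> Prop) : Prop :=
  [/\ (forall s, Sg (mdeg0 d) s <-> exists a : A, s = a%:A),
      (forall a : A, a%:A = 0 :> S -> a = 0) &
      generates_alg (fun s => exists i, Sg (unitdeg i) s)].

Definition graded_module (Sg : multideg d -> S -> Prop) (M : lmodType S)
    (Mg : multideg d -> M -> Prop) : Prop :=
  [/\ (forall n, A_submod (Mg n)),
      (forall a b s m, Sg a s -> Mg b m -> Mg (mdeg_add a b) (s *: m)) &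
      direct_sum_dec Mg].

Definition fin_gen_module (M : lmodType S) : Prop :=
  exists gs : seq M, forall m, exists cs : seq S,
    size cs = size gs /\ m = \sum_(p <- zip cs gs) p.1 *: p.2.

Definition chainA (V : lmodType S) (L N : V -> Prop) (t : nat) : Prop :=
  exists C : nat -> V -> Prop,
    [/\ (forall v, C 0%N v <-> L v), (forall v, C t v <-> N v),
        (forall i, (i <= t)%N -> A_submod (C i)) &
        (forall i, (i < t)%N -> strict_sub (C i) (C i.+1))].

(* lengthA L N c : the A-module N/L has length c *)
Definition lengthA (V : lmodType S) (L N : V -> Prop) (c : nat) : Prop :=
  chainA L N c /\ ~ chainA L N c.+1.

Variable Sg : multideg d -> S -> Prop.

Definition homogeneous_prime (P : S -> Prop) : Prop :=
  [/\ P 0, (forall s t, P s -> P t -> P (s + t)) & (forall s t, P t -> P (s * t))] /\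
  [/\ ~ P 1, (forall s t, P (s * t) -> P s \/ P t) &
      (forall (ds : seq (multideg d)) (f : multideg d -> S), uniq ds ->
         (forall n, n \in ds -> Sg n (f n)) -> P (\sum_(n <- ds) f n) ->
         forall n, n \in ds -> P (f n))].

Definition in_Proj (P : S -> Prop) : Prop :=
  homogeneous_prime P /\ exists n s, [/\ mle (mdeg1 d) n, Sg n s & ~ P s].

Variable M : lmodType S.
Variable Mg : multideg d -> M -> Prop.

(* Graded subquotients N/L of M are represented by the pair (N, L).
   (N/L)_P <> 0 iff some m in N has image in N/L not killed by any s outside P. *)
Definition in_Supp_pp (N L : M -> Prop) (P : S -> Prop) : Prop :=
  in_Proj P /\ exists m, N m /\ forall s, ~ P s -> ~ L (s *: m).

Definition supp_chain (N L : M -> Prop) (t : nat) : Prop :=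
  exists Pc : nat -> S -> Prop,
    (forall i, (i <= t)%N -> in_Supp_pp N L (Pc i)) /\
    (forall i, (i < t)%N -> strict_sub (Pc i) (Pc i.+1)).

(* dim Supp_{++}(N/L) <= s  (dimension of the empty set is -oo) *)
Definition dim_supp_le (N L : M -> Prop) (s : nat) : Prop := ~ supp_chain N L s.+1.

Definition whole : M -> Prop := fun _ => True.
Definition zero : M -> Prop := fun m => m = 0.

Definition homog_seq (xs : seq (S * 'I_d)) : Prop :=
  forall p, p \in xs -> Sg (unitdeg p.2) p.1.

Definition of_type (xs : seq (S * 'I_d)) (k : multideg d) : Prop :=
  forall i, count (fun p => p.2 == i) xs = k i.

Definition addxN (xs : seq (S * 'I_d)) (N L : M -> Prop) : M -> Prop :=
  fun m => exists l (ms : seq M), [/\ L l, size ms = size xs, (forall u, u \in ms -> N u) &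
            m = l + \sum_(p <- zip xs ms) p.1.1 *: p.2].

Definition mm_system (xs : seq (S * 'I_d)) (k : multideg d) (N L : M -> Prop) : Prop :=
  [/\ homog_seq xs, of_type xs k & dim_supp_le N (addxN xs N L) 0].

(* etilde xs N L c : the mixed multiplicity symbol of xs on N/L equals c.
   M/x1M ~ (N, L + x1 N) ;  0 :_M x1 ~ ({m in N | x1 m in L}, L). *)
Inductive etilde : seq (S * 'I_d) -> (M -> Prop) -> (M -> Prop) -> int -> Prop :=
| etilde_nil (N L : M -> Prop) (c : nat) :
    (exists v, forall n, mle v n ->
       lengthA (fun m => Mg n m /\ L m) (fun m => Mg n m /\ N m) c) ->
    etilde [::] N L c%:Z
| etilde_cons (x : S * 'I_d) xs (N L : M -> Prop) (a b : int) :
    etilde xs N (addxN [:: x] N L) a ->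
    etilde xs (fun m => N m /\ L (x.1 *: m)) L b ->
    etilde (x :: xs) N L (a - b).

Section Koszul.
Variable xs : seq (S * 'I_d).
Local Notation r := (size xs).
Local Notation xt := (in_tuple xs).

Definition degI (I : {set 'I_r}) : multideg d :=
  [ffun i => #|[set j in I | (tnth xt j).2 == i]|].

(* K_i(x,M) in degree n, as a predicate on chains {ffun {set 'I_r} -> M} *)
Definition Kpiece (i : nat) (n : multideg d) (c : {ffun {set 'I_r} -> M}) : Prop :=
  forall I : {set 'I_r},
    if #|I| == i then (if [forall l, (degI I l <= n l)%N] then Mg (mdeg_sub n (degI I)) (c I)
                       else c I = 0)
    else c I = 0.

Definition kdiff (c : {ffun {set 'I_r} -> M}) : {ffun {set 'I_r} -> M} :=
  [ffun J : {set 'I_r} => \sum_(j : 'I_r | j \notin J)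
               ((-1) ^+ #|[set l in J | (l < j)%N]| * (tnth xt j).1) *: c (j |: J)].

Definition kcycles i n : {ffun {set 'I_r} -> M} -> Prop :=
  fun c => Kpiece i n c /\ kdiff c = 0.
Definition kbounds i n : {ffun {set 'I_r} -> M} -> Prop :=
  fun c => exists c', Kpiece i.+1 n c' /\ c = kdiff c'.

Definition euler_char (c : int) : Prop :=
  exists v, forall n, mle v n -> exists h : nat -> nat,
    (forall i, (i <= r)%N -> lengthA (kbounds i n) (kcycles i n) (h i)) /\
    \sum_(i < r.+1) (-1) ^+ i * (h i)%:Z = c.
End Koszul.

Definition hilbert_poly (P : {mpoly rat[d]}) : Prop :=
  exists v, forall n, mle v n -> exists c : nat,
    lengthA zero (Mg n) c /\ P.@[fun i => (n i)%:R] = c%:R.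

(* k! times the coefficient of n^k in P : the mixed multiplicity of type k
   when |k| = dim Supp_{++} M *)
Definition mixed_coef (P : {mpoly rat[d]}) (k : multideg d) : rat :=
  (mfact k)%:R * P@_[multinom k i | i < d].

End Graded.

Arguments whole {A S} M _.
Arguments zero {A S} M _.

(* Main.v *)
(* Let H be the Hilbert function of M, and let D_k be the iterated forward difference containing k_i
   times the difference in direction e_i.  All three numbers are the eventual value of D_k H.
   - For the symbol: the kernel and cokernel of multiplication by x_1 : N/L -> N/L show that the first
     difference of H_{N/L} is H_{N/(L + x_1 N)} minus H_{(L : x_1)/L}, which is the recursion defining
     the symbol; it ends with modules whose support has dimension <= 0, for which H is eventually
     constant.
   - For the Euler characteristic: the alternating sum of the lengths of the homology is that of the
     lengths of the Koszul complex, which is D_k H shifted by k.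
   - For the mixed multiplicity: if dim Supp M < t then every difference of order t kills H eventually,
     so P_M has degree at most |k|, and D_k P_M is k! times the coefficient of n^k.
   The bound on the differences of H is proved by Noetherian induction: either some homogeneous
   x splits N/L into two smaller pieces, or ann(N/L) is prime. *)
Require Import Defs.
From HB Require Import structures.
From mathcomp Require Import all_boot all_order all_algebra.
From mathcomp Require Import mpoly.
From mathcomp Require Import boolp zify.
From mathcomp Require classical_sets.
Set Implicit Arguments. Unset Strict Implicit. Unset Printing Implicit Defensive.
Import GRing.Theory.
Local Open Scope ring_scope.

(** * Lengths of subquotients *)

(** Apart from the Koszul complex, every module in play is a subquotient N/L of the one module M,
    kept as a pair of predicates, so no quotient type is formed. Lengths are relations in the
    statement; calculating with them requires finite length of the graded pieces of M, hence of A,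
    which has to be derived from the descending chain condition. The recursion of the symbol does
    not visibly preserve dim Supp(M/xM) <= 0, since 0 :_M x_1 is a submodule. That condition is
    therefore traded for one on the primes of Supp M that contain x, which passes to both branches.
    The trade rests on Nakayama's lemma at a prime: a prime of Supp M containing x lies in
    Supp(M/xM). In the Noetherian induction the two pieces are N/(L + xN) and N/(L : x), the latter
    shifted by the degree of x. Both are quotients of the same N, so only L varies. *)

Lemma predeq (T : Type) (P Q : T -> Prop) : (forall x, P x <-> Q x) -> P = Q.
Proof. by move=> PQ; rewrite predeqE. Qed.

Section Length.
Context {A : comNzRingType} {S : comAlgType A} {V : lmodType S}.
Implicit Types (K L N : V -> Prop).

Definition subP L N := forall v, L v -> N v.
Definition capP L N : V -> Prop := fun v => L v /\ N v.
Definition sumP L N : V -> Prop := fun v => exists l n, [/\ L l, N n & v = l + n].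

Lemma A_submod0 L : A_submod L -> L 0. Proof. by case. Qed.
Lemma A_submodD L u v : A_submod L -> L u -> L v -> L (u + v).
Proof. by case=> _ h _; apply: h. Qed.
Lemma A_submodZ L (a : A) v : A_submod L -> L v -> L (a%:A *: v).
Proof. by case=> _ _ h; apply: h. Qed.
Lemma A_submodN L v : A_submod L -> L v -> L (- v).
Proof. by move=> hL /(A_submodZ (-1) hL); rewrite !scaleN1r. Qed.
Lemma A_submodB L u v : A_submod L -> L u -> L v -> L (u - v).
Proof. by move=> hL Lu Lv; apply: A_submodD => //; apply: A_submodN. Qed.
Lemma A_submodBl L u v : A_submod L -> L u -> L (u + v) -> L v.
Proof. by move=> hL Lu Luv; rewrite -(addKr u v) addrC; apply: A_submodB. Qed.
Lemma A_submod_sum L (I : Type) (r : seq I) (P : pred I) (F : I -> V) :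
  A_submod L -> (forall i, P i -> L (F i)) -> L (\sum_(i <- r | P i) F i).
Proof.
move=> hL hF; apply: (big_ind L) => //; first exact: A_submod0.
by move=> u v; apply: A_submodD.
Qed.

Lemma A_submod_cap K L : A_submod K -> A_submod L -> A_submod (capP K L).
Proof.
move=> hK hL; split; first by split; apply: A_submod0.
- by move=> u v [? ?] [? ?]; split; apply: A_submodD.
- by move=> a v [? ?]; split; apply: A_submodZ.
Qed.

Lemma A_submod_sumP K L : A_submod K -> A_submod L -> A_submod (sumP K L).
Proof.
move=> hK hL; split.
- by exists 0, 0; split; rewrite ?addr0 //; apply: A_submod0.
- move=> _ _ [u [v [Ku Lv ->]]] [u' [v' [Ku' Lv' ->]]].
  by exists (u + u'), (v + v'); split; [exact: A_submodD | exact: A_submodD | rewrite addrACA].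
- move=> a _ [u [v [Ku Lv ->]]].
  by exists (a%:A *: u), (a%:A *: v); split; [exact: A_submodZ | exact: A_submodZ | rewrite scalerDr].
Qed.

Lemma A_submod_zero : A_submod (zero V).
Proof. by split=> // [u v -> -> | a v ->]; rewrite /zero ?addr0 ?scaler0. Qed.

Lemma A_submod_whole : A_submod (whole V).
Proof. by []. Qed.

Inductive chain : (V -> Prop) -> (V -> Prop) -> nat -> Prop :=
| chain0 N : A_submod N -> chain N N 0
| chainS L K N t : chain L K t -> A_submod N -> strict_sub K N -> chain L N t.+1.

Lemma chainAP L N t : chainA L N t <-> chain L N t.
Proof.
split.
- case=> C [/predeq C0 /predeq Ct Csub Cst].
  suff H j : (j <= t)%N -> chain (C 0%N) (C j) j by rewrite -C0 -Ct; apply: H.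
  elim: j => [|j IHj] jt; first by apply: chain0; apply: Csub.
  by apply: chainS (IHj (ltnW jt)) _ _; [apply: Csub | apply: Cst].
- elim=> [N' hN|L' K N' t' _ [C [C0 Ct Csub Cst]] hN hst].
    by exists (fun _ => N'); split.
  exists (fun i => if (i <= t')%N then C i else N'); split.
  + by move=> v; rewrite leq0n.
  + by move=> v; rewrite ltnn.
  + by move=> i _; case: ifP => // /Csub.
  + move=> i; rewrite ltnS => it; rewrite it.
    case: ifP => [/Cst //|/negbT]; rewrite -leqNgt => ti.
    have -> : i = t' by apply/eqP; rewrite eqn_leq it.
    by rewrite (predeq Ct).
Qed.

Lemma chain_submodl L N t : chain L N t -> A_submod L.
Proof. by elim. Qed.

Lemma chain_submodr L N t : chain L N t -> A_submod N.
Proof. by case. Qed.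

Lemma chain_sub L N t : chain L N t -> subP L N.
Proof. by elim=> [N' _ v|L' K N' t' _ LK _ [KN _] v /LK /KN]. Qed.

Lemma chain_trans L K N a b : chain L K a -> chain K N b -> chain L N (a + b).
Proof.
move=> hL hK; elim: hK L a hL => [N' _ |L' K' N' t _ IH hN hst] L a hL; first by rewrite addn0.
by rewrite addnS; apply: chainS hN hst; apply: IH.
Qed.

Lemma sub_dec L N : A_submod N -> A_submod L -> subP L N -> L = N \/ strict_sub L N.
Proof.
move=> hN hL LN; case: (pselect (exists v, N v /\ ~ L v)) => [h|h]; first by right.
left; apply: predeq => v; split=> [/LN //|Nv].
by apply: contrapT => nL; apply: h; exists v.
Qed.

(** Modular law: if e = u + v with u in K, v in a term of the chain and e in the next one, then u =
    e - v lies in K and in N, hence in L, and e is in the smaller term already. So adding K keeps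
    every step strict. *)
Lemma chain_shift K L N t : A_submod K -> chain L N t -> (forall v, K v -> N v -> L v) ->
  chain (sumP K L) (sumP K N) t.
Proof.
move=> hK; elim=> [N' hN _|L' K' N' t' hL IH hN [sKN [e [Ne nKe]]] hi].
  by apply: chain0; apply: A_submod_sumP.
apply: chainS (IH _) _ _.
- by move=> v Kv K'v; apply: hi => //; apply: sKN.
- exact: A_submod_sumP.
- split=> [_ [u [v [Ku K'v ->]]]|]; first by exists u, v; split=> //; apply: sKN.
  exists e; split; first by exists 0, e; split; rewrite ?add0r //; apply: A_submod0.
  case=> u [v [Ku K'v def_e]]; apply: nKe; rewrite def_e.
  apply: A_submodD (chain_submodr hL) _ _ => //; apply: (chain_sub hL).
  apply: hi => //; apply: (@A_submodBl _ v); [by []|exact: sKN|by rewrite addrC -def_e].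
Qed.

(** At each step C < N of the chain, either K meets N in more than C and the part below gains a
    term, or K meets both alike and the part above does. In the first case the part above is shifted
    by adding the intersection of K and N, and may still gain a term at the top. *)
Lemma chain_split_cap K L N t : chain L N t -> A_submod K -> subP L K ->
  exists a b, [/\ chain L (capP K N) a, chain (capP K N) N b & (t <= a + b)%N].
Proof.
move=> + hK; elim=> [N' hN LK|L' C N' t' hL IH hN hst LK].
  have -> : capP K N' = N' by apply: predeq => v; split=> [[]|Nv] //; split=> //; apply: LK.
  by exists 0%N, 0%N; split=> //; apply: chain0.
have [a [b [cha chb le_t]]] := IH LK.
have [hst1 _] := hst.
have hKN := A_submod_cap hK hN; have hKC := A_submod_cap hK (chain_submodr hL).
have [|||eqK|stK] := @sub_dec (capP K C) (capP K N') => //.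
- by move=> v [Kv /hst1 ?]; split.
- rewrite -eqK; exists a, b.+1; split=> //; last by rewrite addnS ltnS.
  by apply: chainS chb hN hst.
have sh : chain (capP K N') (sumP (capP K N') C) b.
  have := chain_shift hKN chb.
  have -> : sumP (capP K N') (capP K C) = capP K N'.
    apply: predeq => v; split=> [[u [w [Ku Kw ->]]]|Kv].
      by apply: A_submodD => //; apply: stK.1.
    by exists v, 0; split; rewrite ?addr0 //; apply: A_submod0.
  by apply=> v [? _] ?; split.
exists a.+1.
have [|||eqN|stN] := @sub_dec (sumP (capP K N') C) N' => //.
- exact: chain_submodr sh.
- by move=> _ [u [w [[_ Nu] /hst1 Nw ->]]]; apply: A_submodD.
- exists b; split; [exact: chainS cha hKN stK| by rewrite -{2}eqN|by rewrite addSn ltnS].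
- exists b.+1; split; [exact: chainS cha hKN stK| exact: chainS sh hN stN|lia].
Qed.

Lemma chain_split K L N t : chain L N t -> A_submod K -> subP L K -> subP K N ->
  exists a b, [/\ chain L K a, chain K N b & (t <= a + b)%N].
Proof.
move=> hc hK LK KN; have := chain_split_cap hc hK LK.
by have -> : capP K N = K by apply: predeq => v; split=> [[]|Kv] //; split=> //; apply: KN.
Qed.

(** [lengthA] excludes only chains with exactly c + 1 steps, so longer ones are coarsened by
    dropping the last term but one. The bound 0 < s reflects that a chain without steps has equal
    ends. *)
Lemma chain_weaken L N s t : chain L N t -> (0 < s <= t)%N -> chain L N s.
Proof.
elim: t => [|t IH] hc st; first by lia.
case/andP: st => s0; rewrite (leq_eqVlt s) ltnS => /orP[/eqP -> //|st].
apply: IH; last by rewrite s0.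
case: t hc st => [|t] hc st; first by lia.
inversion hc as [|? K ? ? hK hN [stK [v [Nv nKv]]]]; subst.
inversion hK as [|? K' ? ? hK' hKs stK']; subst.
apply: (chainS hK') => //; split=> [w /stK'.1/stK //|]; exists v; split=> //.
by move/stK'.1.
Qed.

Lemma lengthA_chain L N c : lengthA L N c -> chain L N c.
Proof. by case=> /chainAP. Qed.

Lemma lengthA_bound L N c t : lengthA L N c -> chain L N t -> (t <= c)%N.
Proof.
case=> _ hn ht; rewrite leqNgt; apply/negP => ct; apply: hn; apply/chainAP.
by apply: chain_weaken ht _; rewrite ct.
Qed.

Lemma lengthA_uniq L N c c' : lengthA L N c -> lengthA L N c' -> c = c'.
Proof.
move=> h h'; apply/eqP; rewrite eqn_leq.
by rewrite (lengthA_bound h (lengthA_chain h')) (lengthA_bound h' (lengthA_chain h)).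
Qed.

Lemma lengthA_add L K N a b : lengthA L K a -> lengthA K N b -> lengthA L N (a + b).
Proof.
move=> ha hb; split; first by apply/chainAP/chain_trans; apply: lengthA_chain; [exact: ha|].
have [ca cb] := (lengthA_chain ha, lengthA_chain hb).
move/chainAP => hc; have [a' [b' [ca' cb']]] :=
  chain_split hc (chain_submodr ca) (chain_sub ca) (chain_sub cb).
by have := lengthA_bound ha ca'; have := lengthA_bound hb cb'; lia.
Qed.

Definition finlen L N := exists c, lengthA L N c.

Lemma finlen_bounded L N B : A_submod L -> A_submod N -> subP L N ->
  (forall t, chain L N t -> (t <= B)%N) -> finlen L N.
Proof.
move=> hL hN LN hB.
have ex : exists t, `[< chain L N t >].
  have [->|st] := sub_dec hN hL LN; first by exists 0%N; apply/asboolP/chain0.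
  by exists 1%N; apply/asboolP; apply: chainS (chain0 hL) hN st.
have bd t : `[< chain L N t >] -> (t <= B)%N by move/asboolP/hB.
case: (ex_maxnP ex bd) => c /asboolP hc mx; exists c; split; first exact/chainAP.
by move/chainAP/asboolP/mx; rewrite ltnn.
Qed.

Lemma finlen_cat L K N : finlen L K -> finlen K N -> finlen L N.
Proof. by case=> a ha [b hb]; exists (a + b)%N; apply: lengthA_add ha hb. Qed.

Lemma finlen_split L K N : finlen L N -> A_submod K -> subP L K -> subP K N ->
  finlen L K /\ finlen K N.
Proof.
case=> c hc hK LK KN; have cc := lengthA_chain hc.
have [hL hN] := (chain_submodl cc, chain_submodr cc).
have refl X : A_submod X -> chain X X 0 by apply: chain0.
have ext X Y : A_submod X -> A_submod Y -> subP X Y -> exists t, chain X Y t.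
  move=> hX hY XY; have [->|st] := sub_dec hY hX XY; first by exists 0%N; apply: chain0.
  by exists 1%N; apply: chainS (chain0 hX) hY st.
have [s hs] := ext _ _ hL hK LK; have [u hu] := ext _ _ hK hN KN.
split; apply: (@finlen_bounded _ _ c) => // t ht.
- by have := lengthA_bound hc (chain_trans ht hu); lia.
- by have := lengthA_bound hc (chain_trans hs ht); lia.
Qed.

Lemma finlen_refl L : A_submod L -> finlen L L.
Proof.
move=> hL; apply: (@finlen_bounded _ _ 0) => // t hc.
case: t hc => // t hc; inversion hc as [|? K ? ? hK hN [_ [v [Lv nKv]]]]; subst.
by case: nKv; apply: (chain_sub hK).
Qed.

(** The value 0 is a default for infinite length. *)
Definition len L N : nat :=
  match pselect (finlen L N) with left h => sval (cid h) | right _ => 0%N end.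

Lemma lenP L N : finlen L N -> lengthA L N (len L N).
Proof. by rewrite /len; case: pselect => // h _; case: cid. Qed.

Lemma len_eq L N c : lengthA L N c -> len L N = c.
Proof. by move=> h; apply: (lengthA_uniq _ h); apply: lenP; exists c. Qed.

Lemma len_add L K N : finlen L K -> finlen K N -> len L N = (len L K + len K N)%N.
Proof. by move=> h1 h2; apply: len_eq; apply: lengthA_add; apply: lenP. Qed.

Lemma len_refl L : A_submod L -> len L L = 0%N.
Proof. by move=> hL; have h := finlen_refl hL; have := len_add h h; lia. Qed.

Lemma len0_eq L N : finlen L N -> len L N = 0%N -> L = N.
Proof.
move=> /[dup] hf /lenP h e; rewrite e in h.
by move/lengthA_chain: h; move E: 0%N => t hc; case: hc E.
Qed.
End Length.

(** * Lengths of isomorphic subquotients *)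

Section LengthMap.
Context {A : comNzRingType} {S S' : comAlgType A} {V : lmodType S} {W : lmodType S'}.
Variables (f : V -> W) (L N : V -> Prop) (L' N' : W -> Prop).
Hypotheses (fD : {morph f : u v / u + v}) (fZ : forall (a : A) v, f (a%:A *: v) = a%:A *: f v).
Hypotheses (hL : A_submod L) (hN : A_submod N) (hL' : A_submod L') (hN' : A_submod N').
Hypotheses (LN : subP L N) (LN' : subP L' N').
Hypothesis fL : forall v, N v -> L v <-> L' (f v).
Hypothesis fN : forall v, N v -> N' (f v).
Hypothesis f_onto : forall w, N' w -> exists v l, [/\ N v, L' l & w = f v + l].

Let pushP (D : V -> Prop) : W -> Prop := fun w => exists v l, [/\ D v, L' l & w = f v + l].
Let pullP (D : W -> Prop) : V -> Prop := fun v => N v /\ D (f v).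

Let f0 : f 0 = 0.
Proof. by apply: (addIr (f 0)); rewrite -fD !add0r. Qed.
Let fB : {morph f : u v / u - v}.
Proof.
by move=> u v; apply: (addIr (f v)); rewrite -fD !addrNK.
Qed.

Let push_submod D : A_submod D -> A_submod (pushP D).
Proof.
move=> hD; split.
- by exists 0, 0; split; rewrite ?f0 ?addr0 //; apply: A_submod0.
- move=> _ _ [u [l [Du Ll ->]]] [u' [l' [Du' Ll' ->]]].
  by exists (u + u'), (l + l'); split; [exact: A_submodD|exact: A_submodD|rewrite fD addrACA].
- move=> a _ [u [l [Du Ll ->]]].
  by exists (a%:A *: u), (a%:A *: l); split; [exact: A_submodZ|exact: A_submodZ|rewrite fZ scalerDr].
Qed.

Let pull_submod D : A_submod D -> A_submod (pullP D).
Proof.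
move=> hD; split.
- by split; rewrite ?f0; apply: A_submod0.
- by move=> u v [? ?] [? ?]; split; rewrite ?fD; apply: A_submodD.
- by move=> a v [? ?]; split; rewrite ?fZ; apply: A_submodZ.
Qed.

Let chain_push K t : chain L K t -> subP K N -> chain L' (pushP K) t.
Proof.
move E : L => X hc; elim: hc E => [X' hX' E|X' Y Z u hc IH hZ [YZ [e [Ze nYe]]] E] sKN.
  have -> : pushP X' = L'.
    apply: predeq => w; split=> [[v [l [Xv Ll ->]]]|Lw].
      by apply: A_submodD => //; apply/fL; [exact: sKN| rewrite E].
    by exists 0, w; split; rewrite ?f0 ?add0r //; apply: A_submod0.
  exact: chain0.
have sYN : subP Y N by move=> v /YZ /sKN.
apply: (chainS (IH E sYN)); first exact: push_submod.
split=> [_ [v [l [Yv Ll ->]]]|]; first by exists v, l; split=> //; apply: YZ.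
exists (f e); split; first by exists e, 0; split; rewrite ?addr0 //; apply: A_submod0.
case=> v [l [Yv Ll e_eq]]; apply: nYe.
rewrite -(addrNK v e); apply: (A_submodD (chain_submodr hc)) => //.
apply: (chain_sub hc); rewrite -E; apply/fL; first by apply: A_submodB => //; [exact: sKN|exact: sYN].
by rewrite fB e_eq addrC addKr.
Qed.

Let chain_pull K t : chain L' K t -> subP K N' -> chain L (pullP K) t.
Proof.
move E : L' => X hc; elim: hc E => [X' hX' E|X' Y Z u hc IH hZ [YZ [e [Ze nYe]]] E] sKN.
  have -> : pullP X' = L.
    apply: predeq => v; rewrite -E; split=> [[Nv Lv]|Lv]; first exact/fL.
    by split; [exact: LN|apply/fL => //; exact: LN].
  exact: chain0.
have sYN : subP Y N' by move=> v /YZ /sKN.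
apply: (chainS (IH E sYN)); first exact: pull_submod.
split=> [v [Nv /YZ Zv]|]; first by split.
have [v [l [Nv Ll e_eq]]] := f_onto (sKN _ Ze).
have Yl : Y l by apply: (chain_sub hc); rewrite -E.
exists v; split; first split=> //.
- by apply: (@A_submodBl _ _ _ _ l); rewrite ?[l + _]addrC -?e_eq //; apply: YZ.
- by case=> _ Yv; apply: nYe; rewrite e_eq; apply: A_submodD (chain_submodr hc) _ _.
Qed.

(** The hypotheses say that f induces an A-linear isomorphism N/L -> N'/L'. Images enlarged by L'
    and preimages cut down to N carry strict chains to strict chains. Only scalars from A commute
    with f and S' may differ from S, which admits maps a -> a g from A to a module over S. *)
Lemma chain_map t : chain L N t <-> chain L' N' t.
Proof.
split=> hc.
- have -> : N' = pushP N.
    apply: predeq => w; split; first exact: f_onto.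
    by case=> v [l [Nv Ll ->]]; apply: A_submodD => //; [exact: fN|exact: LN'].
  exact: chain_push.
- have -> : N = pullP N' by apply: predeq => v; split=> [Nv|[]//]; split=> //; apply: fN.
  exact: chain_pull.
Qed.

Lemma lengthA_map c : lengthA L N c <-> lengthA L' N' c.
Proof.
by rewrite /lengthA; split=> -[/chainAP h1 h2]; (split; first by apply/chainAP/chain_map);
   move/chainAP/chain_map/chainAP.
Qed.

Lemma finlen_map : finlen L N <-> finlen L' N'.
Proof. by split=> -[c /lengthA_map hc]; exists c. Qed.

Lemma len_map : finlen L N -> len L N = len L' N'.
Proof. by move=> h; apply/esym/len_eq/lengthA_map/lenP. Qed.
End LengthMap.

(** * Artinian rings have finite length *)

(** Otherwise a choice of R-successors, iterated from any point of Q, gives an infinite sequence.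
    With R a strict inclusion in either direction this turns both chain conditions into extremal
    elements. *)
Lemma exists_maximal (T : Type) (R : T -> T -> Prop) (Q : T -> Prop) :
  (forall f : nat -> T, (forall n, Q (f n)) -> (forall n, R (f n) (f n.+1)) -> False) ->
  (exists x, Q x) -> exists x, Q x /\ forall y, Q y -> ~ R x y.
Proof.
move=> hinf [x0 Qx0]; apply: contrapT => hno.
have step (x : {x | Q x}) : exists y : {x | Q x}, R (sval x) (sval y).
  apply: contrapT => hn; apply: hno; exists (sval x); split; first exact: svalP.
  by move=> y Qy Rxy; apply: hn; exists (exist _ y Qy).
have [g hg] := choice step.
pose f n := sval (iter n g (exist _ x0 Qx0)).
by apply: (hinf f) => n; rewrite /f /=; [apply: svalP | apply: hg].
Qed.

Section ArtinianLength.
Context {A : comNzRingType}.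
Let RA : lmodType A^o := A^o.
Implicit Types (I J K : RA -> Prop).

Lemma regular_scaleE (a : A) (v : RA) : (a%:A : A^o) *: v = (a * v : A).
Proof. by rewrite /GRing.scale /= mulr1. Qed.

Lemma A_submod_ideal I : A_submod I <-> is_ideal I.
Proof.
split=> [[I0 ID IZ]|[I0 ID IZ]]; split=> // a v Iv; last by rewrite regular_scaleE; apply: IZ.
by rewrite -regular_scaleE; apply: IZ.
Qed.

Lemma A_submodM I (a v : A) : A_submod I -> I v -> I (a * v).
Proof. by move=> hI Iv; rewrite -[_ * _]regular_scaleE; apply: A_submodZ. Qed.

Lemma maximal_avoiding J (x : A) : A_submod J -> x != 0 ->
  exists K, [/\ A_submod K, subP K J, ~ K x &
    forall L, A_submod L -> subP L J -> subP K L -> ~ L x -> L = K].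
Proof.
move=> hJ x0.
(* [P] leaves out 0 because Zorn's lemma also asks for the union of the empty chain. A maximal K
   contains 0 all the same: otherwise it is empty and lies strictly below the zero ideal. *)
pose P K := [/\ forall u v, K u -> K v -> K (u + v), forall a u, K u -> K (a * u), subP K J & ~ K x].
have [F FP Ftot|K [[KD KM KJ Kx] mx]] := @classical_sets.Zorn_bigcup A P.
  split.
  - move=> u v [X FX Xu] [Y FY Yv].
    case: (Ftot X Y FX FY) => h.
    + by exists Y => //; case: (FP _ FY) => YD _ _ _; apply: YD => //; apply: h.
    + by exists X => //; case: (FP _ FX) => YD _ _ _; apply: YD => //; apply: h.
  - by move=> a u [X FX Xu]; exists X => //; case: (FP _ FX) => _ h _ _; apply: h.
  - by move=> u [X FX Xu]; case: (FP _ FX) => _ _ h _; apply: h.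
  - by case=> X FX Xu; case: (FP _ FX) => _ _ _ h; apply: h.
have K0 : K 0.
  apply: contrapT => nK0; apply: (mx (fun u => u = 0)).
    have noK v : ~ K v by move=> /(KM 0); rewrite mul0r.
    split; last by move=> /(_ 0 erefl).
    by move=> v /noK.
  split=> [u v -> ->|a u ->|u ->|/eqP]; rewrite ?addr0 ?mulr0 //; last exact/negP.
  exact: (A_submod0 hJ).
exists K; split=> //; first by apply/A_submod_ideal; split.
move=> L hL LJ KL Lx; apply: contrapT => nLK; apply: (mx L).
  split=> // LK; apply: nLK; apply: predeq => v; split; [exact: LK|exact: KL].
split=> //; first by move=> u v; apply: A_submodD.
by move=> a u; apply: A_submodM.
Qed.

Definition mulker (a : A) J : RA -> Prop := fun v => J v /\ a * v = 0.
Definition mulim (a : A) J : RA -> Prop := fun w => exists2 v, J v & w = a * v.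

Lemma A_submod_mulker a J : A_submod J -> A_submod (mulker a J).
Proof.
move=> hJ; split; first by split; [exact: A_submod0|rewrite mulr0].
- by move=> u v [Ju au] [Jv av]; split; [exact: A_submodD|rewrite mulrDr au av addr0].
- by move=> b v [Jv av]; rewrite regular_scaleE; split; [exact: A_submodM|rewrite mulrCA av mulr0].
Qed.

Lemma A_submod_mulim a J : A_submod J -> A_submod (mulim a J).
Proof.
move=> hJ; split; first by exists 0; [exact: A_submod0|rewrite mulr0].
- by move=> _ _ [u Ju ->] [v Jv ->]; exists (u + v); [exact: A_submodD|rewrite mulrDr].
- by move=> b _ [v Jv ->]; exists (b * v); [exact: A_submodM|rewrite regular_scaleE mulrCA].
Qed.

Lemma finlen_mulker a J : A_submod J -> finlen (mulker a J) J <-> finlen (zero RA) (mulim a J).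
Proof.
move=> hJ; apply: (@finlen_map A A^o A^o A^o A^o (fun v => a * v)) => //.
- by move=> u v; rewrite mulrDr.
- by move=> b v; rewrite !regular_scaleE mulrCA.
- exact: A_submod_mulker.
- exact: A_submod_zero.
- exact: A_submod_mulim.
- by move=> v [].
- by move=> v ->; apply: (A_submod0 (A_submod_mulim a hJ)).
- by move=> v Jv; split=> [[]|].
- by move=> v Jv; exists v.
- by move=> w [v Jv ->]; exists v, 0; split; rewrite ?addr0.
Qed.

(* A minimal ideal J of infinite length would be a vector space over the field A/ann(J), and a
   hyperplane of J, of finite length by minimality, would force J to have finite length. *)
Lemma artinian_finlen : artinian_ring A -> finlen (zero RA) (whole RA).
Proof.
move=> dcc; apply: contrapT => hinf.
have [J [[hJ nJ] minJ]] : exists J, (A_submod J /\ ~ finlen (zero RA) J) /\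
    forall K, A_submod K /\ ~ finlen (zero RA) K -> ~ strict_sub K J.
  apply: (exists_maximal (R := fun J K => strict_sub K J)); last first.
    by exists (whole RA); split=> //; apply: A_submod_whole.
  move=> f hf st; have [n|n|N hN] := dcc f.
  - by apply/A_submod_ideal; case: (hf n).
  - by case: (st n) => h _; apply: h.
  - case: (st N) => _ [v [fv nfv]]; apply: nfv.
    by apply/(hN N.+1).
have fin K : A_submod K -> subP K J -> K <> J -> finlen (zero RA) K.
  move=> hK KJ nKJ; apply: contrapT => nK; apply: (minJ K) => //.
  by have [|] := sub_dec hJ hK KJ.
have sz K : A_submod K -> subP (zero RA) K by move=> hK v ->; apply: A_submod0.
(* If a neither kills J nor maps it onto itself, its kernel and image on J are proper, hence of
   finite length by minimality, and J is an extension of the image by the kernel. *)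
have dich a : (forall v, J v -> a * v = 0) \/ (forall w, J w -> exists2 v, J v & w = a * v).
  have hK := A_submod_mulker a hJ; have hI := A_submod_mulim a hJ.
  have [eK|nK] := pselect (mulker a J = J); first by left=> v; rewrite -eK => -[].
  have [eJ|nJa] := pselect (mulim a J = J); first by right=> w; rewrite -{1}eJ.
  case: nJ; apply: (@finlen_cat _ _ _ _ (mulker a J)); first by apply: fin => // v [].
  by apply/finlen_mulker => //; apply: fin => // _ [v Jv ->]; apply: A_submodM.
have inv a : (exists2 v, J v & a * v <> 0) -> exists b, forall v, J v -> v = b * (a * v).
  case=> v0 Jv0 av0.
  have onto n : forall w, J w -> exists2 v, J v & w = a ^+ n * v.
    elim: n => [|n IH] w Jw; first by exists w; rewrite ?expr0 ?mul1r.
    have [v Jv ->] := IH _ Jw; case: (dich a) => [/(_ _ Jv0)//|/(_ _ Jv) [u Ju ->]].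
    by exists u; rewrite // exprSr mulrA.
  (* The ideals of those c that act on J like a multiple of a^n descend. At a stable N, a^N acts as
     b a^(N+1); since a^N maps J onto J, b inverts a. *)
  have [n|n c|N /(_ N.+1 (leqnSn N) (a ^+ N))] :=
    dcc (fun n c => exists b, forall v, J v -> (c - b * a ^+ n) * v = 0).
  - split; first by exists 0 => v _; rewrite mul0r subr0 mul0r.
    + move=> c c' [b hb] [b' hb']; exists (b + b') => v Jv.
      have -> : c + c' - (b + b') * a ^+ n = (c - b * a ^+ n) + (c' - b' * a ^+ n).
        by rewrite mulrDl opprD addrACA.
      by rewrite mulrDl hb // hb' // addr0.
    + move=> e c [b hb]; exists (e * b) => v Jv.
      by rewrite -mulrA -mulrBr -mulrA hb // mulr0.
  - by case=> b hb; exists (b * a) => v Jv; rewrite -mulrA -exprS hb.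
  - case=> _ []; first by exists 1 => v _; rewrite mul1r subrr mul0r.
    move=> b hb; exists b => w Jw; have [v Jv ->] := onto N w Jw.
    apply/eqP; rewrite -subr_eq0; apply/eqP.
    by rewrite -[RHS](hb v Jv) exprS mulrBl !mulrA.
have [x [Jx x0]] : exists x, J x /\ x != 0.
  apply: contrapT => nx; apply: nJ.
  have -> : J = zero RA.
    apply: predeq => v; split=> [Jv|]; last exact: sz.
    by apply/eqP; apply: contrapT => /negP v0; apply: nx; exists v.
  exact/finlen_refl/A_submod_zero.
have [K [hK KJ nKx mx]] := maximal_avoiding hJ x0.
have KneJ : K <> J by move=> e; apply: nKx; rewrite e.
apply: nJ; apply: (@finlen_cat _ _ _ _ K); first exact: fin.
(* K is maximal among the submodules of J without x, so K + Av contains x for each v outside K. Here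
   a acts invertibly, as a v = 0 would put x into K. Simplicity of J/K follows. *)
have decomp v : J v -> ~ K v -> exists a u, [/\ K u, x = u + a * v & exists b, v = b * (a * v)].
  move=> Jv nKv.
  pose L w := exists u a, K u /\ w = u + a * v.
  have hL : A_submod L.
    split; first by exists 0, 0; rewrite mul0r addr0; split=> //; apply: A_submod0.
    - move=> _ _ [u [a [Ku ->]]] [u' [a' [Ku' ->]]]; exists (u + u'), (a + a').
      by split; [exact: A_submodD|rewrite mulrDl addrACA].
    - move=> b _ [u [a [Ku ->]]]; exists (b * u), (b * a).
      by split; [exact: A_submodM|rewrite regular_scaleE mulrDr mulrA].
  have [u [a [Ku ex]]] : L x.
    apply: contrapT => nLx; apply: nKv; rewrite -(mx L) //.
    - by exists 0, 1; rewrite mul1r add0r; split=> //; apply: A_submod0.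
    - by move=> _ [u [a [Ku ->]]]; apply: A_submodD => //; [exact: KJ|exact: A_submodM].
    - by move=> u Ku; exists u, 0; rewrite mul0r addr0.
  exists a, u; split=> //.
  have [|b hb] := inv a; last by exists b; apply: hb.
  by exists v => // av; apply: nKx; rewrite ex av addr0.
apply: (@finlen_bounded _ _ _ _ _ 1) => // t hc.
have simple L : A_submod L -> strict_sub K L -> subP L J -> L = J.
  move=> hL [KL [v [Lv nKv]]] LJ; apply: predeq => w; split; first exact: LJ.
  move=> Jw; have Lx : L x.
    have [a [u [Ku -> _]]] := decomp v (LJ _ Lv) nKv.
    by apply: A_submodD => //; [exact: KL|exact: A_submodM].
  have [Kw|nKw] := pselect (K w); first exact: KL.
  have [a [u [Ku ex [b ->]]]] := decomp w Jw nKw.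
  apply: A_submodM => //; apply: (@A_submodBl _ _ _ _ u) => //; first exact: KL.
  by rewrite -[u + _]ex.
case: t hc => [|[|t]] // hc.
inversion hc as [|? X ? ? hX hN [XJ [v [Jv nXv]]]]; subst.
inversion hX as [|? Y ? ? hY hXs [YX [w [Xw nYw]]]]; subst.
case: nXv; rewrite (simple X) //; split; first exact: chain_sub hX.
by exists w; split=> // Kw; apply: nYw; apply: (chain_sub hY).
Qed.
End ArtinianLength.

(** * Noetherian modules *)

Section Noetherian.
Context {A : comNzRingType} {S : comAlgType A} {V : lmodType S}.
Implicit Types (C : nat -> V -> Prop) (L N : V -> Prop) (ys : seq S).

Definition cyc (g : V) : V -> Prop := fun v => exists a : A, v = a%:A *: g.

Lemma A_submod_cyc g : A_submod (cyc g).
Proof.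
split; first by exists 0; rewrite scale0r scale0r.
- by move=> _ _ [a ->] [b ->]; exists (a + b); rewrite scalerDl scalerDl.
- by move=> b _ [a ->]; exists (b * a); rewrite scalerA -scalerAl mul1r scalerA.
Qed.

(** The map a -> a g identifies A/I with (Ag + L)/L, where I is the ideal of those a with a g in
    L. *)
Lemma finlen_cyc (L : V -> Prop) g : finlen (zero (A^o : lmodType A^o)) (whole _) ->
  A_submod L -> finlen L (sumP (cyc g) L).
Proof.
move=> hA hL.
pose I : (A^o : lmodType A^o) -> Prop := fun a => L ((a : A)%:A *: g).
have fZ (a : A) (v : A^o) : ((a * v : A)%:A : S) *: g = a%:A *: ((v : A)%:A *: g).
  by rewrite scalerA -scalerAl mul1r scalerA.
have hI : A_submod I.
  split; first by rewrite /I scale0r scale0r; apply: A_submod0.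
  - by move=> u v Iu Iv; rewrite /I scalerDl scalerDl; apply: A_submodD.
  - by move=> a v Iv; rewrite /I regular_scaleE fZ; apply: A_submodZ.
have [_ hf] := finlen_split hA hI (fun v (e : v = 0) => eq_ind_r I (A_submod0 hI) e) (fun _ _ => Logic.I).
suff e : finlen I (whole _) <-> finlen L (sumP (cyc g) L) by apply/e.
apply: (@finlen_map A A^o S (A^o : lmodType A^o) V (fun a => (a : A)%:A *: g) I (whole _)
  L (sumP (cyc g) L)).
- by move=> u v; rewrite scalerDl scalerDl.
- by move=> a v; rewrite regular_scaleE fZ.
- by [].
- exact: A_submod_whole.
- by [].
- by apply: A_submod_sumP => //; apply: A_submod_cyc.
- by [].
- by move=> v Lv; exists 0, v; split; rewrite ?add0r //; exists 0; rewrite scale0r scale0r.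
- by [].
- move=> v _; exists (v%:A *: g), 0; split; rewrite ?addr0 //; first by exists v.
  exact: A_submod0.
- by move=> _ [_ [l [[a ->] Ll ->]]]; exists a, l.
Qed.

(** Submodules over the subalgebra A[ys], which is not constructed itself. *)
Definition ysubmod ys L := A_submod L /\ forall y, y \in ys -> forall v, L v -> L (y *: v).

Definition acc ys N := forall C, (forall n, ysubmod ys (C n)) ->
  (forall n, subP (C n) (C n.+1)) -> (forall n, subP (C n) N) ->
  exists K, forall n, (K <= n)%N -> subP (C n) (C K).

Lemma chain_mono C : (forall n, subP (C n) (C n.+1)) ->
  forall m n, (m <= n)%N -> subP (C m) (C n).
Proof.
move=> hC m n; elim: n => [|n IH]; first by rewrite leqn0 => /eqP -> v.
by rewrite leq_eqVlt ltnS => /orP[/eqP -> v|/IH h v /h /hC].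
Qed.

Lemma acc_finlen N : finlen (zero V) N -> acc [::] N.
Proof.
move=> hN C hC mono CN; have {}hC n : A_submod (C n) by case: (hC n).
have CM := chain_mono mono.
have f0 n : finlen (zero V) (C n).
  by have [] := finlen_split hN (hC n) (fun v e => eq_ind_r _ (A_submod0 (hC n)) e) (CN n).
have fmn m n : (m <= n)%N -> finlen (C m) (C n).
  move=> mn; have [] // := finlen_split (f0 n) (hC m) _ (CM _ _ mn).
  by move=> v ->; apply: A_submod0.
have bd n : (len (zero V) (C n) <= len (zero V) N)%N.
  have [|h1 h2] := finlen_split hN (hC n) _ (CN n); first by move=> v ->; apply: A_submod0.
  by rewrite (len_add h1 h2) leq_addr.
have ex : exists t, `[< exists n, len (zero V) (C n) = t >].
  by exists (len (zero V) (C 0%N)); apply/asboolP; exists 0%N.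
have [|t /asboolP[K eK] mx] := ex_maxnP ex (m := len (zero V) N).
  by move=> i /asboolP[n <-].
exists K => n Kn; have h := fmn _ _ Kn.
have le : (len (zero V) (C n) <= t)%N by apply: mx; apply/asboolP; exists n.
rewrite (@len0_eq _ _ _ (C K) (C n)) //.
by move: le; rewrite (len_add (f0 K) h) eK; lia.
Qed.

Definition spanY (y : S) N : V -> Prop := fun v => exists n (f : nat -> V),
  (forall i, N (f i)) /\ v = \sum_(i < n) y ^+ i *: f i.

(** Coefficients of y^i in expressions of degree at most i with value in L. The action of y on V may
    satisfy relations, so one element can have several leading coefficients; [lead_inj] tolerates
    this. *)
Definition lead (y : S) N L (i : nat) : V -> Prop := fun m => N m /\ exists f : nat -> V,
  (forall j, N (f j)) /\ L (y ^+ i *: m + \sum_(j < i) y ^+ j *: f j).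

Lemma spanY_pad y N n (f : nat -> V) v : A_submod N -> (forall i, N (f i)) ->
  v = \sum_(i < n) y ^+ i *: f i -> forall m, (n <= m)%N ->
  exists g : nat -> V, (forall i, N (g i)) /\ v = \sum_(i < m) y ^+ i *: g i.
Proof.
move=> hN Nf -> m nm; exists (fun i => if (i < n)%N then f i else 0); split.
  by move=> i; case: ifP => // _; apply: A_submod0.
rewrite (big_ord_widen_cond m xpredT (fun i => y ^+ i *: f i) nm).
by rewrite big_mkcond /=; apply: eq_bigr => i _; case: ifP; rewrite ?scaler0.
Qed.

Lemma spanY_submod y ys N : ysubmod ys N -> ysubmod (y :: ys) (spanY y N).
Proof.
move=> [hN yN]; split; first split.
- by exists 0%N, (fun _ => 0); split=> [_|]; [exact: A_submod0|rewrite big_ord0].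
- move=> u v [n [f [Nf eu]]] [m [g [Ng ev]]].
  have [f' [Nf' ->]] := spanY_pad hN Nf eu (leq_maxl n m).
  have [g' [Ng' ->]] := spanY_pad hN Ng ev (leq_maxr n m).
  exists (maxn n m), (fun i => f' i + g' i); split; first by move=> i; apply: A_submodD.
  by rewrite -big_split; apply: eq_bigr => i _; rewrite scalerDr.
- move=> a v [n [f [Nf ->]]]; exists n, (fun i => a%:A *: f i); split.
    by move=> i; apply: A_submodZ.
  by rewrite scaler_sumr; apply: eq_bigr => i _; rewrite !scalerA mulrC.
- move=> z; rewrite inE => /orP[/eqP -> | zys] v [n [f [Nf ->]]].
    exists n.+1, (fun i => if i is j.+1 then f j else 0); split.
      by case=> // ; apply: A_submod0.
    rewrite big_ord_recl scaler0 add0r scaler_sumr; apply: eq_bigr => i _.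
    by rewrite scalerA -exprS.
  exists n, (fun i => z *: f i); split; first by move=> i; apply: yN.
  by rewrite scaler_sumr; apply: eq_bigr => i _; rewrite !scalerA mulrC.
Qed.

Lemma lead_submod y ys N L i : ysubmod ys N -> ysubmod (y :: ys) L -> ysubmod ys (lead y N L i).
Proof.
move=> [hN yN] [hL yL].
split; first split.
- split; first exact: A_submod0.
  exists (fun _ => 0); split=> [_|]; first exact: A_submod0.
  rewrite scaler0 add0r big1 ?scaler0 //; first exact: A_submod0.
  by move=> j _; rewrite scaler0.
- move=> u v [Nu [f [Nf Lf]]] [Nv [g [Ng Lg]]]; split; first exact: A_submodD.
  exists (fun i => f i + g i); split; first by move=> j; apply: A_submodD.
  have := A_submodD hL Lf Lg; rewrite addrACA -scalerDr -big_split /=.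
  by under eq_bigr do rewrite -scalerDr.
- move=> a v [Nv [f [Nf Lf]]]; split; first exact: A_submodZ.
  exists (fun i => a%:A *: f i); split; first by move=> j; apply: A_submodZ.
  have := A_submodZ a hL Lf; rewrite scalerDr scaler_sumr scalerA mulrC -scalerA.
  by under eq_bigr do rewrite scalerA mulrC -scalerA.
- move=> z zys v [Nv [f [Nf Lf]]]; split; first exact: yN.
  exists (fun i => z *: f i); split; first by move=> j; apply: yN.
  have zy : z \in y :: ys by rewrite inE zys orbT.
  have := yL z zy _ Lf; rewrite scalerDr scaler_sumr scalerA mulrC -scalerA.
  by under eq_bigr do rewrite scalerA mulrC -scalerA.
Qed.

Lemma lead_mono y ys N L : ysubmod ys N -> ysubmod (y :: ys) L ->
  forall i, subP (lead y N L i) (lead y N L i.+1).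
Proof.
move=> [hN _] [_ yL] i v [Nv [f [Nf Lf]]]; split=> //.
exists (fun i => if i is j.+1 then f j else 0); split.
  by case=> //; apply: A_submod0.
rewrite big_ord_recl scaler0 add0r.
have := yL y (mem_head _ _) _ Lf; rewrite scalerDr scaler_sumr scalerA -exprS.
by under eq_bigr do rewrite scalerA -exprS.
Qed.

(** Division by leading terms: given an expression for v in L', some element of L has an expression
    of the same degree with the same leading coefficient; subtracting it leaves an element of L'
    with an expression of smaller degree. *)
Lemma lead_inj y ys N L L' : ysubmod ys N -> ysubmod (y :: ys) L -> ysubmod (y :: ys) L' ->
  subP L L' -> subP L' (spanY y N) -> (forall i, subP (lead y N L' i) (lead y N L i)) -> subP L' L.
Proof.
move=> [hN _] [hL _] [hL' _] LL' L'N hl v L'v; have [n [f [Nf ev]]] := L'N _ L'v.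
elim: n f v Nf ev L'v => [|n IH] f v Nf ev L'v.
  by rewrite ev big_ord0; apply: A_submod0.
have [|_ [g [Ng Lg]]] := hl n (f n).
  split=> //; exists f; split=> //.
  by move: L'v; rewrite ev big_ord_recr /= addrC.
rewrite -(subrK (y ^+ n *: f n + \sum_(j < n) y ^+ j *: g j) v).
apply: A_submodD => //; apply: (IH (fun j => f j - g j)).
- by move=> i; apply: A_submodB.
- rewrite ev big_ord_recr /= [X in X - _]addrC opprD addrACA subrr add0r -sumrB.
  by apply: eq_bigr => j _; rewrite scalerBr.
- by apply: A_submodB => //; apply: LL'.
Qed.

(* Hilbert's basis theorem: C n is controlled by the modules D i n of leading coefficients in degree
   i, and the doubly increasing family D i n stabilizes. *)
Lemma acc_spanY y ys N : ysubmod ys N -> acc ys N -> acc (y :: ys) (spanY y N).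
Proof.
move=> hN aN C hC mono CN; pose D i n := lead y N (C n) i.
have hD i n : ysubmod ys (D i n) by apply: lead_submod.
have DN i n : subP (D i n) N by move=> v [].
have Dn i n : subP (D i n) (D i n.+1).
  by move=> v [Nv [f [Nf Cf]]]; split=> //; exists f; split=> //; apply: mono.
have Di i n : subP (D i n) (D i.+1 n) by apply: (lead_mono hN (hC n)).
have Dmn i j m n : (i <= j)%N -> (m <= n)%N -> subP (D i m) (D j n).
  move=> ij mn v /(chain_mono (Dn i) mn).
  exact: (@chain_mono (fun i => D i n) _ i j ij v).
have [K hK] : exists K, forall n, (K <= n)%N -> subP (D n n) (D K K).
  by apply: (aN (fun n => D n n)) => // n; apply: Dmn.
have [k_ hk] := choice (fun i => aN (D i) (hD i) (Dn i) (DN i)).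
(* The diagonal is stable from K on, row i from [k_ i] on. Rows i >= K are controlled by the
   diagonal, so only finitely many rows need a bound of their own. *)
pose K' := (K + \max_(i < K) k_ i)%N.
exists K' => n K'n; apply: (lead_inj hN (hC _) (hC _)) => //.
  exact: (chain_mono mono).
move=> i; have [iK|Ki] := ltnP i K.
- move=> v Dv; apply: (Dmn i i (k_ i)) => //.
    apply: leq_trans (leq_addl _ _); exact: (leq_bigmax (Ordinal iK)).
  move: (Dv); apply: hk; apply: leq_trans K'n; apply: leq_trans (leq_addl _ _).
  exact: (leq_bigmax (Ordinal iK)).
- move=> v Dv; apply: (Dmn K i K K') => //; first exact: leq_addr.
  apply: (hK (maxn i n)); first by rewrite leq_max Ki.
  by apply: Dmn Dv; rewrite ?leq_maxl ?leq_maxr.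
Qed.

Definition S_submod L := A_submod L /\ forall (s : S) v, L v -> L (s *: v).

(** The A-span of the module generators has finite length, and adjoining an algebra generator by
    [spanY] preserves the chain condition. Once all of them are adjoined the result is stable under
    S, hence is all of V. *)
Lemma noetherian_maximal (Q : (V -> Prop) -> Prop) :
  finlen (zero (A^o : lmodType A^o)) (whole _) -> fin_gen_algebra S -> fin_gen_module V ->
  (forall L, Q L -> S_submod L) -> (exists L, Q L) ->
  exists L, Q L /\ forall L', Q L' -> ~ strict_sub L L'.
Proof.
move=> hA [ys gen] [ms fg] QS exQ.
apply: exists_maximal => // C QC st.
pose aspan := foldr (fun m N => sumP (cyc m) N) (zero V).
have asub ms' : A_submod (aspan ms').
  elim: ms' => [|m ms' IH]; first exact: A_submod_zero.
  by apply: A_submod_sumP => //; apply: A_submod_cyc.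
have afin ms' : finlen (zero V) (aspan ms').
  elim: ms' => [|m ms' IH]; first exact/finlen_refl/A_submod_zero.
  by apply: finlen_cat IH _; apply: finlen_cyc.
pose N zs := foldr spanY (aspan ms) zs.
have hN zs : ysubmod zs (N zs) /\ acc zs (N zs).
  elim: zs => [|y zs [IH1 IH2]]; first by split; [split; first exact: asub | apply: acc_finlen; exact: afin].
  by split; [apply: spanY_submod|apply: acc_spanY].
have mN zs m : m \in ms -> N zs m.
  move=> mms; elim: zs => [|y zs IH] /=.
    elim: (ms) mms => //= m' ms' IH; rewrite inE => /orP[/eqP <-|/IH h].
      exists m, 0; split; rewrite ?addr0 //; last exact: A_submod0.
      by exists 1; rewrite scale1r scale1r.
    exists 0, m; rewrite add0r; split=> //.
    by exists 0; rewrite scale0r scale0r.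
  exists 1%N, (fun i => m); split=> //.
  by rewrite big_ord1 expr0 scale1r.
have [[hNy yN] aN] := hN ys.
have NS s : forall v, N ys v -> N ys (s *: v).
  elim/gen: s => [a v|s t hs ht v Nv|s t hs ht v Nv|s sys v].
  - exact: A_submodZ.
  - by rewrite scalerDl; apply: A_submodD; [|apply: hs|apply: ht].
  - by rewrite -scalerA; apply: hs; apply: ht.
  - exact: yN.
have NT v : N ys v.
  have [cs [sz ->]] := fg v; rewrite big_seq; apply: A_submod_sum => // -[c m] cm /=.
  by apply: NS; apply: mN; rewrite -(@unzip2_zip _ _ cs ms) ?sz //; apply: (map_f snd cm).
have [|||K hK] := aN C; last 1 first.
- by have [_ [v [Cv nCv]]] := st K; apply: nCv; apply: (hK K.+1).
- by move=> n; have [hC SC] := QS _ (QC n); split=> // y _; exact: SC.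
- by move=> n; have [] := st n.
- by move=> n v _; apply: NT.
Qed.
End Noetherian.

(** * Graded submodules and Hilbert functions *)

Section Multidegrees.
Context {d : nat}.
Implicit Types u v w n : multideg d.

Lemma mdeg_addC u v : mdeg_add u v = mdeg_add v u.
Proof. by apply/ffunP => i; rewrite !ffunE addnC. Qed.
Lemma mdeg_addA u v w : mdeg_add u (mdeg_add v w) = mdeg_add (mdeg_add u v) w.
Proof. by apply/ffunP => i; rewrite !ffunE addnA. Qed.
Lemma mdeg_addK u v : mdeg_sub (mdeg_add u v) u = v.
Proof. by apply/ffunP => i; rewrite !ffunE addKn. Qed.
Lemma mdeg_subK u v : mle u v -> mdeg_add u (mdeg_sub v u) = v.
Proof. by move=> uv; apply/ffunP => i; rewrite !ffunE subnKC. Qed.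
Lemma mdeg_addI u : injective (mdeg_add u).
Proof. by move=> v w /(congr1 (fun n => mdeg_sub n u)); rewrite !mdeg_addK. Qed.
Lemma mle_trans v u w : mle u v -> mle v w -> mle u w.
Proof. by move=> uv vw i; apply: leq_trans (uv i) (vw i). Qed.
Lemma mle_addr u v : mle u (mdeg_add u v).
Proof. by move=> i; rewrite ffunE leq_addr. Qed.
Lemma mle_addl u v : mle v (mdeg_add u v).
Proof. by move=> i; rewrite ffunE leq_addl. Qed.

(** Gives multidegrees a total order compatible with addition, needed to speak of top components. *)
Definition mono_of u : 'X_{1..d} := [multinom u i | i < d].
Lemma mono_ofD u v : mono_of (mdeg_add u v) = (mono_of u + mono_of v)%MM.
Proof. by apply/mnmP => i; rewrite mnmDE !mnmE ffunE. Qed.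
Lemma mono_of_inj : injective mono_of.
Proof. by move=> u v /mnmP h; apply/ffunP => i; have := h i; rewrite !mnmE. Qed.

Lemma exists_top (ds : seq (multideg d)) (Q : multideg d -> Prop) :
  (exists2 n, n \in ds & Q n) ->
  exists n, [/\ n \in ds, Q n & forall m, m \in ds -> Q m -> (mono_of m <= mono_of n)%O].
Proof.
elim: ds => [[]//|a ds IH] [n]; rewrite inE => nd Qn.
have [h|h] := pselect (exists2 n, n \in ds & Q n); last first.
  exists a; have [/eqP e|nds] := orP nd; last by case: h; exists n.
  split; [exact: mem_head|by rewrite -e|move=> m].
  by rewrite inE => /orP[/eqP ->//|mds Qm]; case: h; exists m.
have [b [bds Qb mx]] := IH h.
have [[Qa ab]|nab] := pselect (Q a /\ (mono_of b <= mono_of a)%O).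
  exists a; split=> //; first exact: mem_head.
  move=> m; rewrite inE => /orP[/eqP ->//|mds Qm].
  exact: Order.POrderTheory.le_trans (mx m mds Qm) ab.
exists b; split=> //; first by rewrite inE bds orbT.
move=> m; rewrite inE => /orP[/eqP -> Qa|mds Qm]; last exact: mx.
by case/orP: (Order.TotalTheory.le_total (mono_of a) (mono_of b)) => // ba; case: nab.
Qed.
End Multidegrees.

(** * Homogeneous components *)

Section Components.
Context {V : zmodType} {d : nat}.
Variable G : multideg d -> V -> Prop.

Definition is_decomp (v : V) (c : multideg d -> V) (ds : seq (multideg d)) : Prop :=
  [/\ uniq ds, forall n, G n (c n), forall n, n \notin ds -> c n = 0 & v = \sum_(n <- ds) c n].

Definition hcomp (v : V) : multideg d -> V :=
  match pselect (exists c, exists ds, is_decomp v c ds) with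
  | left h => sval (cid h) | right _ => fun _ => 0 end.

Definition graded_group := [/\ forall n, G n 0, forall n u v, G n u -> G n v -> G n (u + v),
  forall n u, G n u -> G n (- u) & direct_sum_dec G].

Hypothesis hG : graded_group.

Lemma hcompP v : exists ds, is_decomp v (hcomp v) ds.
Proof.
rewrite /hcomp; case: pselect => [h|[]]; first by case: cid.
have [G0 _ _ [dec _]] := hG; have [ds [f [ud Gf ->]]] := dec v.
exists (fun n => if n \in ds then f n else 0), ds; split=> //.
- by move=> n; case: ifP => // /Gf.
- by move=> n /negbTE ->.
- by rewrite [RHS]big_seq big_seq; apply: eq_bigr => n ->.
Qed.

Lemma big_widen_seq (ds es : seq (multideg d)) (c : multideg d -> V) : uniq ds -> uniq es ->
  {subset ds <= es} -> (forall n, n \notin ds -> c n = 0) ->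
  \sum_(n <- ds) c n = \sum_(n <- es) c n.
Proof.
move=> ud ue sub c0; rewrite [RHS](bigID (mem ds)) /= [X in _ + X]big1 ?addr0 //.
rewrite -[RHS]big_filter; apply: perm_big; apply: uniq_perm; rewrite ?filter_uniq // => n.
by rewrite mem_filter; apply/idP/andP => [nd|[]//]; split=> //; apply: sub.
Qed.

Lemma hcomp_uniq v c ds : is_decomp v c ds -> hcomp v = c.
Proof.
move=> [ud Gc c0 ev]; have [es [ue Gh h0 ev']] := hcompP v.
have [G0 GD GN [_ inj]] := hG.
pose fs := undup (ds ++ es).
have sumd : \sum_(n <- ds) c n = \sum_(n <- fs) c n.
  by apply: big_widen_seq; rewrite ?undup_uniq // => n nd; rewrite mem_undup mem_cat nd.
have sume : \sum_(n <- es) hcomp v n = \sum_(n <- fs) hcomp v n.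
  by apply: big_widen_seq; rewrite ?undup_uniq // => n nd; rewrite mem_undup mem_cat nd orbT.
apply: funext => n; have [nf|nf] := boolP (n \in fs).
  apply/eqP; rewrite -subr_eq0; apply/eqP.
  apply: (inj fs (fun n => hcomp v n - c n)) => //; first exact: undup_uniq.
    by move=> m _; apply: GD => //; apply: GN.
  by rewrite sumrB -sumd -sume -ev -ev' subrr.
by move: nf; rewrite mem_undup mem_cat negb_or => /andP[/c0 -> /h0 ->].
Qed.

Lemma hcomp_in v n : G n (hcomp v n).
Proof. by have [ds []] := hcompP v. Qed.

Lemma hcomp_hom m v n : G m v -> hcomp v n = if n == m then v else 0.
Proof.
move=> Gv; have [G0 _ _ _] := hG.
rewrite (@hcomp_uniq v (fun n => if n == m then v else 0) [:: m]) //; split=> //.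
- by move=> k; case: eqP => // ->.
- by move=> k; rewrite inE => /negbTE ->.
- by rewrite big_seq1 eqxx.
Qed.

Lemma hcomp_id n v : G n v -> hcomp v n = v.
Proof. by move=> Gv; rewrite (hcomp_hom _ Gv) eqxx. Qed.

Lemma hcompD u v n : hcomp (u + v) n = hcomp u n + hcomp v n.
Proof.
have [G0 GD _ _] := hG.
have [ds [ud Gu u0 eu]] := hcompP u; have [es [ue Gv v0 ev]] := hcompP v.
rewrite (@hcomp_uniq _ (fun n => hcomp u n + hcomp v n) (undup (ds ++ es))) //; split.
- exact: undup_uniq.
- by move=> k; apply: GD.
- by move=> k; rewrite mem_undup mem_cat negb_or => /andP[/u0 -> /v0 ->]; rewrite addr0.
- rewrite big_split {1}eu {1}ev; congr (_ + _); apply: big_widen_seq; rewrite ?undup_uniq // => k kd.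
    by rewrite mem_undup mem_cat kd.
  by rewrite mem_undup mem_cat kd orbT.
Qed.

Lemma hcomp0 n : hcomp 0 n = 0.
Proof. by apply: (addIr (hcomp 0 n)); rewrite -hcompD !add0r. Qed.

Lemma hcomp_sum (I : Type) (r : seq I) (F : I -> V) n :
  hcomp (\sum_(i <- r) F i) n = \sum_(i <- r) hcomp (F i) n.
Proof.
elim: r => [|i r IH]; first by rewrite !big_nil hcomp0.
by rewrite !big_cons hcompD IH.
Qed.

Lemma hcomp_bound v : exists K, forall (n : multideg d) i, (K < n i)%N -> hcomp v n = 0.
Proof.
have [ds [_ _ v0 _]] := hcompP v.
suff [K hK] : exists K, forall (n : multideg d) i, n \in ds -> (n i <= K)%N.
  exists K => n i Kn; apply: v0; apply/negP => /(hK n i); lia.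
elim: ds {v0} => [|n ds [K hK]]; first by exists 0%N.
exists (maxn K (\max_(i < d) n i)) => m i; rewrite inE => /orP[/eqP ->|/(hK _ i) mK].
  by rewrite leq_max (leq_bigmax i) orbT.
by rewrite leq_max mK.
Qed.

Lemma hcomp_ind (Q : V -> Prop) v : Q 0 -> (forall u w, Q u -> Q w -> Q (u + w)) ->
  (forall n, Q (hcomp v n)) -> Q v.
Proof.
move=> Q0 QD Qh; have [ds [_ _ _ ->]] := hcompP v.
by elim/big_ind: _ => // n _; apply: Qh.
Qed.
End Components.

Section GradedModules.
Context {A : comNzRingType} {S : comAlgType A} {d : nat} {Sg : multideg d -> S -> Prop}.
Context {M : lmodType S} {Mg : multideg d -> M -> Prop}.
Hypotheses (hS : graded_algebra Sg) (hst : standard Sg) (hM : graded_module Sg Mg).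
Implicit Types (K L N : M -> Prop).

Lemma graded_groupS : graded_group Sg.
Proof.
have [hSg _ _ dS] := hS; split=> //.
- by move=> n; case: (hSg n).
- by move=> n; case: (hSg n).
- by move=> n u Su; have [_ _ /(_ (-1) _ Su)] := hSg n; rewrite scaleN1r mulN1r.
Qed.

Lemma graded_groupM : graded_group Mg.
Proof.
have [hMg _ dM] := hM; split=> //.
- by move=> n; apply: A_submod0.
- by move=> n u v; apply: A_submodD.
- by move=> n u; apply: A_submodN.
Qed.

Lemma hcomp_scale a s m b : Sg a s -> hcomp Mg (s *: m) (mdeg_add a b) = s *: hcomp Mg m b
  /\ forall n, ~ mle a n -> hcomp Mg (s *: m) n = 0.
Proof.
move=> Ss; have [G0 _ _ _] := graded_groupM; have [_ MM _] := hM.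
have [ds [ud Gm m0 em]] := hcompP graded_groupM m.
pose c (n : multideg d) := if [forall i, (a i <= n i)%N] then s *: hcomp Mg m (mdeg_sub n a) else 0.
have le_forall (n : multideg d) : [forall i, (a i <= n i)%N] -> mle a n by move/forallP.
have forall_le (n : multideg d) : mle a n -> [forall i, (a i <= n i)%N] by move=> h; apply/forallP.
suff -> : hcomp Mg (s *: m) = c.
  rewrite /c forall_le ?mdeg_addK; last exact: mle_addr.
  by split=> // n an; case: ifP => // /le_forall.
apply: (@hcomp_uniq _ _ _ graded_groupM _ _ [seq mdeg_add a n | n <- ds]); split.
- by rewrite map_inj_uniq //; apply: mdeg_addI.
- move=> n; rewrite /c; case: ifP => // /le_forall an.
  by rewrite -{1}(mdeg_subK an); apply: MM.
- move=> n nd; rewrite /c; case: ifP => // /le_forall an.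
  rewrite m0 ?scaler0 //; apply: contra nd => nd; apply/mapP; exists (mdeg_sub n a) => //.
  by rewrite mdeg_subK.
- rewrite {1}em scaler_sumr big_map; apply: eq_bigr => n _.
  by rewrite /c forall_le ?mdeg_addK //; apply: mle_addr.
Qed.

Lemma hcomp_scale_add a s m b : Sg a s -> hcomp Mg (s *: m) (mdeg_add a b) = s *: hcomp Mg m b.
Proof. by case/(hcomp_scale m b). Qed.

Lemma hcomp_scale_out a s m n : Sg a s -> ~ mle a n -> hcomp Mg (s *: m) n = 0.
Proof. by case/(hcomp_scale m n) => _; apply. Qed.

Lemma S_submodP L : (forall u v, L u -> L v -> L (u + v)) -> L 0 ->
  (forall a s v, Sg a s -> L v -> L (s *: v)) -> S_submod L.
Proof.
move=> LD L0 LZ; suff LS (s : S) v : L v -> L (s *: v) by split=> //; split=> // c v; apply: LS.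
move=> Lv; apply: (@hcomp_ind _ _ _ graded_groupS (fun s => L (s *: v)) s).
- by rewrite scale0r.
- by move=> t u ? ?; rewrite scalerDl; apply: LD.
- by move=> n; exact: (LZ n _ _ (hcomp_in graded_groupS s n) Lv).
Qed.

Definition gsub L := S_submod L /\ forall v n, L v -> L (hcomp Mg v n).

Lemma gsubA L : gsub L -> A_submod L. Proof. by case=> -[]. Qed.
Lemma gsubS L (s : S) v : gsub L -> L v -> L (s *: v). Proof. by case=> -[_ h] _; apply: h. Qed.
Lemma gsub_comp L v n : gsub L -> L v -> L (hcomp Mg v n). Proof. by case=> _; apply. Qed.

Lemma gsub_hcomp_ind L v : gsub L -> (forall n, L (hcomp Mg v n)) -> L v.
Proof.
move=> hL Lh; apply: (@hcomp_ind _ _ _ graded_groupM) => //; first exact: A_submod0 (gsubA hL).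
by move=> u w; apply: A_submodD; apply: gsubA.
Qed.

Lemma gsub_zero : gsub (zero M).
Proof.
split; last by move=> v n ->; rewrite hcomp0 //; apply: graded_groupM.
by split; [exact: A_submod_zero|move=> s v ->; rewrite /zero scaler0].
Qed.

Definition addx (x : S) N L : M -> Prop := fun m => exists l u, [/\ L l, N u & m = l + x *: u].
Definition colon (x : S) N L : M -> Prop := fun m => N m /\ L (x *: m).

Lemma addxN1 (x : S * 'I_d) N L : addxN [:: x] N L = addx x.1 N L.
Proof.
apply: predeq => m; split.
- case=> l [[|u [|? ?]] [Ll // _ Nu ->]]; exists l, u; split=> //; first exact/Nu/mem_head.
  by rewrite /= big_seq1.
- case=> l [u [Ll Nu ->]]; exists l, [:: u]; split=> //; last by rewrite /= big_seq1.
  by move=> w; rewrite inE => /eqP ->.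
Qed.

Lemma gsub_addx a x N L : Sg a x -> gsub N -> gsub L -> gsub (addx x N L).
Proof.
move=> Sx hN hL; split; first split; first split.
- exists 0, 0; rewrite scaler0 addr0; split=> //; apply: A_submod0; exact: gsubA.
- move=> _ _ [l [u [Ll Nu ->]]] [l' [u' [Ll' Nu' ->]]]; exists (l + l'), (u + u').
  by rewrite scalerDr addrACA; split=> //; apply: A_submodD => //; apply: gsubA.
- move=> c _ [l [u [Ll Nu ->]]]; exists (c%:A *: l), (c%:A *: u).
  by split; [exact: gsubS|exact: gsubS|rewrite scalerDr !scalerA mulrC].
- move=> s _ [l [u [Ll Nu ->]]]; exists (s *: l), (s *: u).
  by split; [exact: gsubS|exact: gsubS|rewrite scalerDr !scalerA mulrC].
- move=> _ n [l [u [Ll Nu ->]]]; rewrite (hcompD graded_groupM).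
  have [an|nan] := pselect (mle a n).
    rewrite -{2}(mdeg_subK an) (hcomp_scale_add _ _ Sx).
    by exists (hcomp Mg l n), (hcomp Mg u (mdeg_sub n a)); split=> //; apply: gsub_comp.
  rewrite (hcomp_scale_out _ Sx nan); exists (hcomp Mg l n), 0; rewrite scaler0; split=> //.
    exact: gsub_comp.
  exact: (A_submod0 (gsubA hN)).
Qed.

Lemma gsub_colon a x N L : Sg a x -> gsub N -> gsub L -> gsub (colon x N L).
Proof.
move=> Sx hN hL; split; first split; first split.
- by split; rewrite ?scaler0; apply: A_submod0; apply: gsubA.
- move=> u v [Nu Lu] [Nv Lv]; split; rewrite ?scalerDr; apply: A_submodD => //; exact: gsubA.
- by move=> c v [Nv Lv]; split; rewrite ?scalerA ?[x * _]mulrC -?scalerA; apply: gsubS.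
- by move=> s v [Nv Lv]; split; rewrite ?scalerA ?[x * _]mulrC -?scalerA; apply: gsubS.
- move=> v n [Nv Lv]; split; first exact: gsub_comp.
  by rewrite -(hcomp_scale_add _ _ Sx); apply: gsub_comp.
Qed.

Hypothesis finA : finlen (zero (A^o : lmodType A^o)) (whole _).
Hypotheses (fgS : fin_gen_algebra S) (fgM : fin_gen_module M).

(** For an A-submodule W of M_n, the elements living in degrees >= n with n-th component in W form
    an S-submodule [T W], because only S_0 = A maps degree n to itself. Take [T W] maximal with W of
    finite length; then W = M_n, since adding a cyclic module Ag keeps the length finite. *)
Lemma finlen_zero_piece n : finlen (zero M) (Mg n).
Proof.
have hMn : A_submod (Mg n) by case: hM.
pose T W : M -> Prop := fun m => W (hcomp Mg m n) /\ forall b, ~ mle n b -> hcomp Mg m b = 0.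
have TW W : A_submod W -> subP W (Mg n) -> S_submod (T W).
  move=> hW WM; apply: S_submodP.
  - move=> u v [Wu u0] [Wv v0]; split; first by rewrite (hcompD graded_groupM); apply: A_submodD.
    by move=> b nb; rewrite (hcompD graded_groupM) u0 // v0 // addr0.
  - by split=> [|b _]; rewrite (hcomp0 graded_groupM) //; apply: A_submod0.
  - move=> a s v Ss [Wv v0]; split=> [|b nb].
      have [an|nan] := pselect (mle a n); last first.
        by rewrite (hcomp_scale_out _ Ss nan); apply: A_submod0.
      rewrite -{1}(mdeg_subK an) (hcomp_scale_add _ _ Ss).
      have [a0|na] := pselect (forall i, a i = 0%N).
        have ea : a = Defs.mdeg0 d by apply/ffunP => i; rewrite ffunE.
        have -> : mdeg_sub n a = n by apply/ffunP => i; rewrite !ffunE a0 subn0.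
        have [S0 _ _] := hst; move: Ss; rewrite ea => /S0 [c ->].
        exact: A_submodZ.
      rewrite v0 ?scaler0; first exact: A_submod0.
      move=> h; apply: na => i; have := h i; have := an i; rewrite ffunE; lia.
    have [an|nan] := pselect (mle a b); last by rewrite (hcomp_scale_out _ Ss nan).
    rewrite -{1}(mdeg_subK an) (hcomp_scale_add _ _ Ss) v0 ?scaler0 // => h; apply: nb => i.
    by have := h i; rewrite ffunE; lia.
pose Q L := exists W, [/\ A_submod W, subP W (Mg n), finlen (zero M) W & L = T W].
have [||L [[W [hW WM fW ->]] mx]] := @noetherian_maximal A S M Q finA fgS fgM.
- by move=> L [W [hW WM _ ->]]; apply: TW.
- exists (T (zero M)), (zero M); split=> //; first exact: A_submod_zero.
    by move=> v ->; apply: A_submod0.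
  exact/finlen_refl/A_submod_zero.
have [<- //|[_ [g [Mgg nWg]]]] := sub_dec hMn hW WM.
have hW' : A_submod (sumP (cyc g) W) by apply: A_submod_sumP => //; apply: A_submod_cyc.
case: (mx (T (sumP (cyc g) W))).
  exists (sumP (cyc g) W); split=> //.
  - by move=> _ [_ [w [[a ->] Ww ->]]]; apply: A_submodD; [|exact: A_submodZ|exact: WM].
  - by apply: finlen_cat fW _; apply: finlen_cyc.
split; first move=> m [Wm m0]; first split=> //.
  by exists 0, (hcomp Mg m n); split; rewrite ?add0r //; exists 0; rewrite scale0r scale0r.
exists g; rewrite /T (hcomp_id graded_groupM Mgg); split; last by case.
split.
  exists g, 0; split; rewrite ?addr0 //; last exact: A_submod0.
  by exists 1; rewrite scale1r scale1r.
move=> b nb; rewrite (hcomp_hom graded_groupM _ Mgg); case: eqP => // e.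
by case: nb; rewrite e => i.
Qed.

Definition hilb N L n : nat := len (capP (Mg n) L) (capP (Mg n) N).

Lemma gsub_cap L n : gsub L -> A_submod (capP (Mg n) L).
Proof. by move=> hL; apply: A_submod_cap (gsubA hL); case: hM. Qed.

Lemma finlen_piece N L n : gsub N -> gsub L -> subP L N ->
  finlen (capP (Mg n) L) (capP (Mg n) N).
Proof.
move=> hN hL LN.
have [||_ h] := finlen_split (finlen_zero_piece n) (gsub_cap n hL).
- by move=> v ->; apply: A_submod0; apply: gsub_cap.
- by move=> v [].
have [||//] := finlen_split h (gsub_cap n hN).
- by move=> v [? ?]; split=> //; apply: LN.
- by move=> v [].
Qed.

Lemma hilb_add N K L n : gsub N -> gsub K -> gsub L -> subP L K -> subP K N ->
  hilb N L n = (hilb K L n + hilb N K n)%N.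
Proof. by move=> hN hK hL LK KN; apply: len_add; apply: finlen_piece. Qed.

Lemma hilb_eq0 N L n : gsub N -> gsub L -> subP L N -> (forall m, Mg n m -> N m -> L m) ->
  hilb N L n = 0%N.
Proof.
move=> hN hL LN h; rewrite /hilb.
have -> : capP (Mg n) N = capP (Mg n) L; last by apply: len_refl; apply: gsub_cap.
by apply: predeq => v; split=> -[? ?]; split=> //; [apply: h|apply: LN].
Qed.

Lemma sub_addx x N L : gsub N -> subP L (addx x N L).
Proof.
move=> hN l Ll; exists l, 0; rewrite scaler0 addr0; split=> //; exact: (A_submod0 (gsubA hN)).
Qed.

Lemma addx_sub x N L : gsub N -> subP L N -> subP (addx x N L) N.
Proof.
move=> hN LN _ [l [u [/LN Nl Nu ->]]]; apply: A_submodD => //; first exact: gsubA.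
exact: gsubS.
Qed.

Lemma sub_colon x N L : gsub L -> subP L N -> subP L (colon x N L).
Proof. by move=> hL LN l Ll; split; [exact: LN|exact: gsubS]. Qed.

(** Multiplication by x identifies N/(L : x) in degree n with (L + xN)/L in degree a + n. *)
Lemma hilb_scale a x N L n : Sg a x -> gsub N -> gsub L -> subP L N ->
  hilb N L (mdeg_add a n) = (hilb N (addx x N L) (mdeg_add a n) + hilb N (colon x N L) n)%N.
Proof.
move=> Sx hN hL LN; have hx := gsub_addx Sx hN hL; have hc := gsub_colon Sx hN hL.
have [_ MM _] := hM.
rewrite (@hilb_add N (addx x N L) L) //; [|exact: sub_addx|exact: addx_sub].
rewrite addnC; congr (_ + _)%N; apply/esym.
apply: (@len_map A S S M M (fun m => x *: m)).
- by move=> u v; rewrite scalerDr.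
- by move=> c v; rewrite !scalerA mulrC.
- exact: gsub_cap.
- exact: gsub_cap.
- exact: gsub_cap.
- exact: gsub_cap.
- by move=> v [? []].
- by move=> v [? ?]; split=> //; apply: sub_addx.
- move=> v [Mv Nv]; split=> [[_ [_ Lv]]|[_ Lv]]; split=> //; exact: MM.
- move=> v [Mv Nv]; split; first exact: MM.
  by exists 0, v; rewrite add0r; split=> //; exact: (A_submod0 (gsubA hL)).
- move=> w [Mw [l [u [Ll Nu ew]]]].
  (* As w is homogeneous, u and l can be replaced by their components of degrees n and a + n. *)
  exists (hcomp Mg u n), (hcomp Mg l (mdeg_add a n)).
  split; [split|split|].
  + exact: hcomp_in graded_groupM _ _.
  + exact: gsub_comp.
  + exact: hcomp_in graded_groupM _ _.
  + exact: gsub_comp.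
  + by rewrite -(hcomp_id graded_groupM Mw) ew (hcompD graded_groupM) (hcomp_scale_add _ _ Sx) addrC.
- by apply: finlen_piece => // v [].
Qed.
End GradedModules.

(** * Degree of the Hilbert function and dimension of the support *)

Section Differences.
Context {d : nat} {V : zmodType}.
Implicit Types (f g : multideg d -> V) (js : seq 'I_d).

Definition nabla (i : 'I_d) f : multideg d -> V :=
  fun n => f (mdeg_add (unitdeg i) n) - f n.

Fixpoint nablas js f : multideg d -> V :=
  if js is i :: js' then nablas js' (nabla i f) else f.

Definition eventually (P : multideg d -> Prop) := exists v, forall n, mle v n -> P n.

Lemma eventually_and P Q : eventually P -> eventually Q -> eventually (fun n => P n /\ Q n).
Proof.
move=> [v hv] [w hw]; exists (mdeg_add v w) => n h.
by split; [apply: hv | apply: hw]; apply: mle_trans h; [apply: mle_addr | apply: mle_addl].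
Qed.

Lemma eventually_impl (P Q : multideg d -> Prop) :
  (forall n, P n -> Q n) -> eventually P -> eventually Q.
Proof. by move=> PQ [v hv]; exists v => n /hv /PQ. Qed.

Lemma eventually_shift a P : eventually P -> eventually (fun n => P (mdeg_add a n)).
Proof. by move=> [v hv]; exists v => n h; apply: hv; apply: mle_trans h (mle_addl _ _). Qed.

Lemma eventually_unshift a P : eventually (fun n => P (mdeg_add a n)) -> eventually P.
Proof.
move=> [v hv]; exists (mdeg_add a v) => n h.
rewrite -(@mdeg_subK _ a n); first apply: hv => i.
  by have := h i; rewrite !ffunE; lia.
exact: mle_trans (mle_addr _ _) h.
Qed.

Lemma eventually_ex P : eventually P -> exists n, P n.
Proof. by case=> v h; exists v; apply: h. Qed.

Lemma nablas_local js f g v : (forall n, mle v n -> f n = g n) ->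
  forall n, mle v n -> nablas js f n = nablas js g n.
Proof.
elim: js f g => [|i js IH] f g fg n vn /=; first exact: fg.
apply: IH => // m vm; rewrite /nabla !fg //; exact: mle_trans vm (mle_addl _ _).
Qed.

Lemma nablas_ext js f g : f =1 g -> nablas js f =1 nablas js g.
Proof. by move=> /funext ->. Qed.

Lemma nablasD js f g n : nablas js (fun n => f n + g n) n = nablas js f n + nablas js g n.
Proof.
elim: js f g => [|i js IH] f g //=; rewrite -IH; apply: nablas_ext => m.
by rewrite /nabla opprD addrACA.
Qed.

Lemma nablasN js f n : nablas js (fun n => - f n) n = - nablas js f n.
Proof.
elim: js f => [|i js IH] f //=; rewrite -IH; apply: nablas_ext => m.
by rewrite /nabla opprB opprK addrC.
Qed.

Lemma nablasB js f g n : nablas js (fun n => f n - g n) n = nablas js f n - nablas js g n.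
Proof. by rewrite nablasD nablasN. Qed.

Lemma nablas_shift js a f n :
  nablas js (fun n => f (mdeg_add a n)) n = nablas js f (mdeg_add a n).
Proof.
elim: js f => [|i js IH] f //=; rewrite -IH; apply: nablas_ext => m.
by rewrite /nabla !mdeg_addA [mdeg_add a (unitdeg i)]mdeg_addC.
Qed.

Lemma nablas0 js n : nablas js (fun _ => 0) n = 0.
Proof.
elim: js => //= i js IH; rewrite -[RHS]IH; apply: nablas_ext => m.
by rewrite /nabla subrr.
Qed.

Lemma nablas_eventually0 js f : eventually (fun n => f n = 0) ->
  eventually (fun n => nablas js f n = 0).
Proof.
by case=> v hv; exists v => n vn; rewrite (@nablas_local js f (fun _ => 0) v) ?nablas0.
Qed.

Lemma nablas_cat js js' f n : nablas (js ++ js') f n = nablas js' (nablas js f) n.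
Proof. by elim: js f => //= i js IH f. Qed.
End Differences.

(** * Annihilators, prime quotients and the vanishing of differences *)

Section Vanishing.
Context {A : comNzRingType} {S : comAlgType A} {d : nat} {Sg : multideg d -> S -> Prop}.
Context {M : lmodType S} {Mg : multideg d -> M -> Prop}.
Hypotheses (hS : graded_algebra Sg) (hst : standard Sg) (hM : graded_module Sg Mg).
Local Notation gsub := (@gsub A S d M Mg).
Local Notation hilb := (@hilb A S d M Mg).
Let GS := graded_groupS hS.
Let GM := graded_groupM hM.
Implicit Types (K L N : M -> Prop).

Definition annP N L : S -> Prop := fun s => forall m, N m -> L (s *: m).

Section Ann.
Variables N L : M -> Prop.
Hypotheses (hN : gsub N) (hL : gsub L).

Lemma annPD s t : annP N L s -> annP N L t -> annP N L (s + t).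
Proof. by move=> hs ht m Nm; rewrite scalerDl; apply: A_submodD (gsubA hL) (hs m Nm) (ht m Nm). Qed.

Lemma annP0 : annP N L 0.
Proof. by move=> m _; rewrite scale0r; apply: A_submod0 (gsubA hL). Qed.

Lemma annPM s t : annP N L t -> annP N L (s * t).
Proof. by move=> ht m Nm; rewrite -scalerA; apply: gsubS hL (ht m Nm). Qed.

Lemma annP_sum (I : Type) (r : seq I) (F : I -> S) :
  (forall i, annP N L (F i)) -> annP N L (\sum_(i <- r) F i).
Proof.
move=> hF; elim: r => [|i r IH]; first by rewrite big_nil; apply: annP0.
by rewrite big_cons; apply: annPD.
Qed.

(** For u homogeneous of degree c, the component of s u in degree n + c is s_n u, and it lies in L
    together with s u. *)
Lemma annP_comp s n : annP N L s -> annP N L (hcomp Sg s n).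
Proof.
move=> hs m Nm; apply: (gsub_hcomp_ind hM hL) => b.
have [nb|nnb] := pselect (mle n b); last first.
  rewrite (hcomp_scale_out hM _ (hcomp_in GS s n) nnb); exact: A_submod0 (gsubA hL).
rewrite -(mdeg_subK nb) (hcomp_scale_add hM _ _ (hcomp_in GS s n)).
set c := mdeg_sub b n; set u := hcomp Mg m c.
have Mu : Mg c u by apply: hcomp_in GM _ _.
have Nu : N u by apply: gsub_comp.
have := gsub_comp (mdeg_add n c) hL (hs u Nu).
have [ds [ud _ s0 {1}->]] := hcompP GS s; rewrite scaler_suml (hcomp_sum GM).
have [_ MM _] := hM.
have term a : hcomp Mg (hcomp Sg s a *: u) (mdeg_add n c) = if a == n then hcomp Sg s a *: u else 0.
  rewrite (hcomp_hom GM _ (MM _ _ _ _ (hcomp_in GS s a) Mu)).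
  case: (a =P n) => [->|na]; first by rewrite eqxx.
  case: eqP => // e; case: na; apply/esym/(@mdeg_addI _ c).
  by rewrite mdeg_addC e mdeg_addC.
under eq_bigr do rewrite term.
have [nd|nd] := boolP (n \in ds).
  rewrite (bigD1_seq n) //= eqxx big1 ?addr0 // => a /negbTE -> //.
by move=> _; rewrite s0 // scale0r; apply: A_submod0 (gsubA hL).
Qed.

(** As S is standard, an element of degree n with n_i > 0 is a sum of products with a factor of
    degree e_i. Generation passes through inhomogeneous elements, so the induction treats
    components: when a product contributes to degree n, one factor has positive i-th degree. *)
Lemma annP_high i : (forall s, Sg (unitdeg i) s -> annP N L s) ->
  forall n s, Sg n s -> (0 < n i)%N -> annP N L s.
Proof.
move=> hi n s Ss ni; rewrite -(hcomp_id GS Ss).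
have [_ SM S1 _] := hS; have [S0 _ gen] := hst.
elim/gen: s n ni {Ss} => [a|s t hs ht|s t hs ht|s [j Sj]] n ni.
- have S0a : Sg (Defs.mdeg0 d) a%:A by apply/S0; exists a.
  rewrite (hcomp_hom GS _ S0a); case: eqP => [e|_]; last exact: annP0.
  by move: ni; rewrite e ffunE.
- by rewrite (hcompD GS); apply: annPD; [apply: hs|apply: ht].
- have [ds [_ _ _ ->]] := hcompP GS s; have [es [_ _ _ ->]] := hcompP GS t.
  rewrite mulr_suml (hcomp_sum GS); apply: annP_sum => a.
  rewrite mulr_sumr (hcomp_sum GS); apply: annP_sum => b.
  rewrite (hcomp_hom GS _ (SM _ _ _ _ (hcomp_in GS s a) (hcomp_in GS t b))).
  case: eqP => [e|_]; last exact: annP0.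
  have [ai|bi] : (0 < a i)%N \/ (0 < b i)%N by move: ni; rewrite e ffunE; lia.
    by rewrite mulrC; apply: annPM; apply: hs.
  by apply: annPM; apply: ht.
- rewrite (hcomp_hom GS _ Sj); case: eqP => [e|_]; last exact: annP0.
  by apply: hi; move: ni Sj; rewrite e ffunE; case: (i =P j) => // ->.
Qed.

Hypothesis LN : subP L N.
Hypothesis dich : forall a x, Sg a x -> annP N L x \/ forall m, N m -> L (x *: m) -> L m.

(* Compare the components of top degree of s and m, for a monomial order, among those outside the
   annihilator and outside L. *)
Lemma ann_regular s m : ~ annP N L s -> N m -> ~ L m -> ~ L (s *: m).
Proof.
move=> ns Nm nLm Lsm.
have [ds [ud _ s0 es]] := hcompP GS s; have [bs [ub _ m0 em]] := hcompP GM m.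
have inds n : ~ annP N L (hcomp Sg s n) -> n \in ds.
  by move=> h; apply: contrapT => /negP /s0 e; apply: h; rewrite e; apply: annP0.
have inbs n : ~ L (hcomp Mg m n) -> n \in bs.
  by move=> h; apply: contrapT => /negP /m0 e; apply: h; rewrite e; apply: A_submod0 (gsubA hL).
have [|n [nds nn nmax]] := @exists_top _ ds (fun n => ~ annP N L (hcomp Sg s n)).
  apply: contrapT => h; apply: ns; apply: (hcomp_ind GS annP0 annPD) => n.
  by apply: contrapT => h'; apply: h; exists n => //; apply: inds.
have [|b [bbs nb bmax]] := @exists_top _ bs (fun b => ~ L (hcomp Mg m b)).
  apply: contrapT => h; apply: nLm; apply: (gsub_hcomp_ind hM hL) => b.
  by apply: contrapT => h'; apply: h; exists b => //; apply: inbs.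
have := gsub_comp (mdeg_add n b) hL Lsm.
rewrite {1}es scaler_suml (hcomp_sum GM) (bigD1_seq n) //= addrC.
rewrite (hcomp_scale_add hM _ _ (hcomp_in GS s n)) => h0.
have [//|hh] := dich (hcomp_in GS s n); apply: nb; apply: hh; first exact: gsub_comp b hN Nm.
apply: A_submodBl (gsubA hL) _ h0.
rewrite big_seq_cond; apply: A_submod_sum; first exact: (gsubA hL).
move=> a /andP[ads /eqP an].
have [hann|hann] := pselect (annP N L (hcomp Sg s a)); first exact/(gsub_comp _ hL)/hann.
have lt_a : (mono_of a < mono_of n)%O.
  by rewrite Order.POrderTheory.lt_neqAle nmax // andbT; apply/eqP => /mono_of_inj.
have [le_a|nle_a] := pselect (mle a (mdeg_add n b)); last first.
  by rewrite (hcomp_scale_out hM _ (hcomp_in GS s a) nle_a); apply: A_submod0 (gsubA hL).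
rewrite -(mdeg_subK le_a) (hcomp_scale_add hM _ _ (hcomp_in GS s a)).
apply: (gsubS _ hL); set c := mdeg_sub _ a; apply: contrapT => nLc.
(* If the component of m in degree c were outside L, then c <= b, and a < n would give a + c < n +
   b, whereas a + c = n + b. *)
have := ltmc_le_add lt_a (bmax c (inbs _ nLc) nLc).
by rewrite -!mono_ofD /c mdeg_subK // Order.POrderTheory.ltxx.
Qed.

Lemma annP_prime : ~ subP N L -> homogeneous_prime Sg (annP N L).
Proof.
move=> nNL; have [m [Nm nLm]] : exists m, N m /\ ~ L m.
  by apply: contrapT => h; apply: nNL => m Nm; apply: contrapT => nLm; apply: h; exists m.
split; first by split; [exact: annP0|exact: annPD|exact: annPM].
split.
- by move/(_ m Nm); rewrite scale1r.
- move=> s t hst'; apply: contrapT => /not_orP[ns nt].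
  apply: (ann_regular ns (gsubS t hN Nm)); first exact: ann_regular.
  by rewrite scalerA; apply: hst'.
- move=> ds f ud Sf hP n nds.
  suff <- : hcomp Sg (\sum_(n <- ds) f n) n = f n by apply: annP_comp.
  rewrite (hcomp_sum GS) (bigD1_seq n) //= (hcomp_id GS (Sf n nds)) big_seq_cond big1 ?addr0 //.
  move=> k /andP[kds /negbTE kn]; rewrite (hcomp_hom GS _ (Sf k kds)) eq_sym kn //.
Qed.

Lemma annP_Supp : ~ subP N L -> (forall i, exists x, Sg (unitdeg i) x /\ ~ annP N L x) ->
  in_Supp_pp Sg N L (annP N L).
Proof.
move=> nNL hx; have pr := annP_prime nNL; have [x hx'] := choice hx.
split; last first.
  have [m [Nm nLm]] : exists m, N m /\ ~ L m.
    by apply: contrapT => h; apply: nNL => m Nm; apply: contrapT => nLm; apply: h; exists m.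
  by exists m; split=> // s ns; apply: ann_regular.
(* The product of the x_i has degree (1,...,1) and avoids the prime, so the annihilator does not
   contain S_{++}. *)
split=> //; exists (Defs.mdeg1 d), (\prod_(i < d) x i); split=> //.
  have [_ SM S1 _] := hS.
  have -> : Defs.mdeg1 d = [ffun j => (\sum_(i < d) (unitdeg i j))%N].
    apply/ffunP => j; rewrite !ffunE (bigD1 j) //= ffunE eqxx big1 ?addn0 // => i /negbTE ij.
    by rewrite ffunE eq_sym ij.
  have -> : [ffun j => (\sum_(i < d) (unitdeg i j))%N] = \big[@mdeg_add d/Defs.mdeg0 d]_(i < d) unitdeg i.
    apply/ffunP => j; rewrite ffunE; elim/big_rec2: _ => [|i u v _ ->]; first by rewrite ffunE.
    by rewrite [RHS]ffunE.
  elim/big_rec2: _ => // i u v _ Su; apply: SM => //; exact: (hx' i).1.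
have [[_ _ _] [n1 pm _]] := pr.
elim/big_ind: _ => // [u v nu nv /pm[]//|i _]; exact: (hx' i).2.
Qed.
End Ann.

Hypothesis finA : finlen (zero (A^o : lmodType A^o)) (whole _).
Hypotheses (fgS : fin_gen_algebra S) (fgM : fin_gen_module M).

(** [E k] is stable under S: homogeneous elements of positive i-th degree send N into L, the others
    keep the i-th degree. The [E k] ascend and exhaust N, because an element has boundedly many
    degrees; so some [E k] is N. *)
Lemma annP_vanish N L i : gsub N -> gsub L -> (forall s, Sg (unitdeg i) s -> annP N L s) ->
  eventually (fun n => forall m, Mg n m -> N m -> L m).
Proof.
move=> hN hL hi.
pose E k m := N m /\ forall n : multideg d, (k < n i)%N -> L (hcomp Mg m n).
have subE k : S_submod (E k).
  apply: (S_submodP hS).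
  - move=> u v [Nu Lu] [Nv Lv]; split; first exact: A_submodD (gsubA hN) _ _.
    by move=> n kn; rewrite (hcompD GM); apply: A_submodD (gsubA hL) (Lu n kn) (Lv n kn).
  - split=> [|n _]; first exact: A_submod0 (gsubA hN).
    by rewrite (hcomp0 GM); apply: A_submod0 (gsubA hL).
  - move=> a s v Ss [Nv Lv]; split=> [|n kn]; first exact: (gsubS s hN Nv).
    have [an|nan] := pselect (mle a n); last first.
      by rewrite (hcomp_scale_out hM _ Ss nan); apply: A_submod0 (gsubA hL).
    rewrite -(mdeg_subK an) (hcomp_scale_add hM _ _ Ss).
    have [a0|apos] := posnP (a i).
      by apply: (gsubS _ hL); apply: Lv; rewrite ffunE a0 subn0.
    by apply: (annP_high hL hi Ss apos); apply: gsub_comp.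
have [||_ [[k ->] mx]] := @noetherian_maximal A S M (fun L' => exists k, L' = E k) finA fgS fgM.
- by move=> _ [k ->].
- by exists (E 0%N), 0%N.
exists [ffun=> k.+1] => n kn m Mm Nm.
suff [_ h] : E k m.
  by rewrite -(hcomp_id GM Mm); apply: h; have := kn i; rewrite ffunE.
have [k' hk'] := hcomp_bound GM m.
apply: contrapT => nE; apply: (mx (E (maxn k k'))); first by exists (maxn k k').
split=> [w [Nw Lw]|].
  by split=> // n' h; apply: Lw; move: h; rewrite gtn_max => /andP[].
exists m; split=> //; split=> // n'; rewrite gtn_max => /andP[_ /hk' ->].
exact: A_submod0 (gsubA hL).
Qed.

Definition hilbz N L : multideg d -> int := fun n => (hilb N L n)%:Z.

Lemma supp_chain_mono N L L' t : subP L L' -> supp_chain Sg N L' t -> supp_chain Sg N L t.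
Proof.
move=> LL' [Pc [h1 h2]]; exists Pc; split=> // i /h1 [hP [m [Nm hm]]]; split=> //.
by exists m; split=> // s /hm h /LL'.
Qed.

Lemma nablas_hilb_exact js a x N L : Sg a x -> gsub N -> gsub L -> subP L N ->
  eventually (fun n => nablas js (hilbz N (addx x N L)) n = 0) ->
  eventually (fun n => nablas js (hilbz N (colon x N L)) n = 0) ->
  eventually (fun n => nablas js (hilbz N L) n = 0).
Proof.
move=> Sx hN hL LN h1 h2; apply: (@eventually_unshift d a).
have := eventually_and (eventually_shift a h1) h2; apply: eventually_impl => n [e1 e2].
rewrite -nablas_shift.
rewrite (@nablas_ext _ _ _ _ (fun n => hilbz N (addx x N L) (mdeg_add a n) + hilbz N (colon x N L) n)).
  by rewrite nablasD nablas_shift e1 e2 addr0.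
by move=> m; rewrite /hilbz (hilb_scale hS hst hM finA fgS fgM m Sx) // PoszD.
Qed.

(* By Noetherian induction every homogeneous element kills N/L' or acts injectively on it. *)
Lemma exists_prime_quotient N L js : gsub N -> gsub L -> subP L N ->
  ~ eventually (fun n => nablas js (hilbz N L) n = 0) ->
  exists L', [/\ gsub L', subP L L', subP L' N,
    ~ eventually (fun n => nablas js (hilbz N L') n = 0) &
    [/\ in_Supp_pp Sg N L' (annP N L'), forall i, exists x, Sg (unitdeg i) x /\ ~ annP N L' x &
      forall a x, Sg a x -> annP N L' x \/ forall m, N m -> L' (x *: m) -> L' m]].
Proof.
move=> hN hL0 LN0 nev0.
have [||L' [[hL LL' LN nev] mx]] := @noetherian_maximal A S M
  (fun L' => [/\ gsub L', subP L L', subP L' N &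
     ~ eventually (fun n => nablas js (hilbz N L') n = 0)]) finA fgS fgM.
- by move=> K [[]].
- by exists L; split.
exists L'.
have dich a x : Sg a x -> annP N L' x \/ (forall m, N m -> L' (x *: m) -> L' m).
  move=> Sx; have [|nann] := pselect (annP N L' x); first by left.
  right; apply: contrapT => nreg; apply: nev.
  have hx := gsub_addx hM Sx hN hL; have hc := gsub_colon hM Sx hN hL.
  have Lx : subP L' (addx x N L') by exact: (@sub_addx A S d M Mg x N L' hN).
  have Lc : subP L' (colon x N L') by exact: (@sub_colon A S d M Mg x N L' hL LN).
  apply: (nablas_hilb_exact Sx hN hL LN); apply: contrapT => nev'.
  - apply: (mx (addx x N L')).
      by split=> //; [move=> v /LL' /Lx | exact: (addx_sub hN LN)].
    split=> //; apply: contrapT => h; apply: nann => m Nm; apply: contrapT => nL.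
    apply: h; exists (x *: m); split=> //; exists 0, m; rewrite add0r; split=> //.
    exact: A_submod0 (gsubA hL).
  - apply: (mx (colon x N L')).
      by split=> // [v /LL' /Lc | v []].
    split=> //; apply: contrapT => h; apply: nreg => m Nm Lxm; apply: contrapT => nL.
    by apply: h; exists m.
have nNL : ~ subP N L'.
  move=> NL; apply: nev; apply: nablas_eventually0; exists (Defs.mdeg0 d) => n _.
  by rewrite /hilbz (hilb_eq0 hM) // => m _; apply: NL.
(* If all of S_i killed N/L', its Hilbert function would vanish for large n. *)
have hx i : exists x, Sg (unitdeg i) x /\ ~ annP N L' x.
  apply: contrapT => hi; apply: nev; apply: nablas_eventually0.
  have [|v hv] := @annP_vanish N L' i hN hL.
    by move=> s Ss; apply: contrapT => ns; apply: hi; exists s.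
  by exists v => n vn; rewrite /hilbz (hilb_eq0 hM) // => m; apply: hv.
by split=> //; split=> //; apply: annP_Supp.
Qed.

(* The degree of the Hilbert function is at most the dimension of the support: for a prime quotient,
   a chain in the support of N/(L + xN), x of degree e_i outside P = ann(N/L), extends by P. *)
Lemma nablas_hilb_vanish N t js L : gsub N -> gsub L -> subP L N ->
  ~ supp_chain Sg N L t -> size js = t ->
  eventually (fun n => nablas js (hilbz N L) n = 0).
Proof.
move=> hN; elim: t js L => [|t IH] js L0 hL0 LN0 nch0 szj; apply: contrapT => nev;
  have [L [hL L0L LN {}nev [supp hx dich]]] := exists_prime_quotient hN hL0 LN0 nev;
  have nch := fun c => nch0 (supp_chain_mono L0L c).
  (* For t = 0 the prime ann(N/L) alone is a chain of length 0 in the support. *)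
  by apply: nch; exists (fun _ => annP N L).
case: js szj nev => // i js [szj]; apply.
have [x [Sx nx]] := hx i.
have hLx := gsub_addx hM Sx hN hL.
have reg : colon x N L = L.
  apply: predeq => m; split=> [[Nm Lm]|Lm]; last by split; [exact: LN|exact: (gsubS x hL Lm)].
  by have [//|h] := dich _ _ Sx; apply: h.
have nch' : ~ supp_chain Sg N (addx x N L) t.
  move=> [Pc [h1 h2]]; apply: nch.
  exists (fun j => if j is j'.+1 then Pc j' else annP N L); split.
    case=> // j jt; have [hP [m [Nm hm]]] := h1 j jt; split=> //; exists m; split=> // s /hm h Ls.
    by apply: h; apply: (sub_addx x hN Ls).
  case=> [_|j jt]; last exact: h2.
  have [hP [m [Nm hm]]] := h1 0%N (leq0n _).
  (* Whatever kills N/L also kills N/(L + xN), whose localization at [Pc 0] is nonzero. The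
     inclusion is strict because x kills N/(L + xN) but not N/L. *)
  have sub0 s : annP N L s -> Pc 0%N s.
    by move=> hs; apply: contrapT => /hm; apply; exact: (sub_addx x hN (hs m Nm)).
  split=> //; exists x; split=> //; apply: contrapT => /hm; apply.
  by exists 0, m; rewrite add0r; split=> //; apply: A_submod0 (gsubA hL).
have := IH js _ hLx (addx_sub hN LN) nch' szj.
move/(eventually_shift (unitdeg i)); apply: eventually_impl => n; rewrite -nablas_shift => <- /=.
apply: nablas_ext => m; rewrite /nabla /hilbz (hilb_scale hS hst hM finA fgS fgM m Sx) // reg PoszD.
by rewrite addrK.
Qed.
End Vanishing.

(** * The mixed multiplicity symbol *)

Section Nakayama.
Context {A : comNzRingType} {S : comAlgType A} {M : lmodType S}.
Variable P : S -> Prop.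
Hypotheses (P0 : P 0) (PD : forall s t, P s -> P t -> P (s + t)) (PM : forall s t, P t -> P (s * t)).

Fixpoint pspan (gs : seq M) (v : M) : Prop :=
  if gs is g :: gs' then exists c, P c /\ pspan gs' (v - c *: g) else v = 0.

Lemma pspan0 gs : pspan gs 0.
Proof. by elim: gs => //= g gs IH; exists 0; rewrite scale0r subr0. Qed.

Lemma pspanD gs u v : pspan gs u -> pspan gs v -> pspan gs (u + v).
Proof.
elim: gs u v => [u v -> ->|g gs IH u v [c [Pc hc]] [e [Pe he]]] /=; first by rewrite addr0.
by exists (c + e); split; [exact: PD|rewrite scalerDl opprD addrACA; apply: IH].
Qed.

Lemma pspanZ gs s v : pspan gs v -> pspan gs (s *: v).
Proof.
elim: gs v => [v ->|g gs IH v [c [Pc hc]]] /=; first by rewrite scaler0.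
by exists (s * c); split; [exact: PM|rewrite -scalerA -scalerBr; apply: IH].
Qed.

Lemma pspan_scale gs cs p : P p -> size cs = size gs ->
  pspan gs (p *: \sum_(q <- zip cs gs) q.1 *: q.2).
Proof.
move=> Pp; elim: gs cs => [|g gs IH] [|c cs] //= => [_|[sz]]; first by rewrite big_nil scaler0.
exists (p * c); split; first by rewrite mulrC; apply: PM.
by rewrite big_cons /= scalerDr scalerA addrC addKr; apply: IH.
Qed.

Lemma pspan_kill gs t v : (forall g, g \in gs -> t *: g = 0) -> pspan gs v -> t *: v = 0.
Proof.
elim: gs v => [v _ ->|g gs IH v tg [c [_ hc]]]; first by rewrite scaler0.
rewrite -[v](subrK (c *: g)) scalerDr (IH _ _ hc) => [|h hgs].
  by rewrite add0r scalerA mulrC -scalerA tg ?scaler0 // mem_head.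
by apply: tg; rewrite inE hgs orbT.
Qed.

Hypothesis Pprime : forall s t, P (s * t) -> P s \/ P t.
Hypothesis P1 : ~ P 1.

(* Nakayama's lemma over the localization at P, by eliminating one generator at a time. *)
Lemma nakayama_elim (gs : seq M) :
  (forall g, g \in gs -> exists s, ~ P s /\ pspan gs (s *: g)) ->
  exists t, ~ P t /\ forall g, g \in gs -> t *: g = 0.
Proof.
elim: gs => [|g0 gs IH] h; first by exists 1.
have [s0 [ns0 [c0 [Pc0 hc0]]]] := h g0 (mem_head _ _).
(* Moving the coefficient c0 of g0 to the left keeps the factor of g0 outside P and expresses that
   multiple of g0 through the remaining generators. *)
pose s' := s0 - c0.
have ns' : ~ P s' by move=> Ps'; apply: ns0; rewrite -(subrK c0 s0); apply: PD.
have {}hc0 : pspan gs (s' *: g0) by rewrite scalerBl.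
have [|t [nt tg]] := IH.
  move=> g ggs; have [|s [ns [c [Pc hc]]]] := h g; first by rewrite inE ggs orbT.
  exists (s' * s); split; first by case/Pprime.
  rewrite -scalerA -(subrK (c *: g0) (s *: g)) scalerDr; apply: pspanD; first exact: pspanZ.
  by rewrite scalerA mulrC -scalerA; apply: pspanZ.
exists (t * s'); split; first by case/Pprime.
move=> g; rewrite inE -scalerA => /orP[/eqP ->|ggs]; first exact: pspan_kill tg hc0.
by rewrite scalerA mulrC -scalerA tg // scaler0.
Qed.
End Nakayama.

(** If M/xM vanished at P, then M_P = x M_P would lie in P M_P, and Nakayama's lemma would give some
    t outside P killing M. *)
Lemma Supp_quotient (A : comNzRingType) (S : comAlgType A) (d : nat) (Sg : multideg d -> S -> Prop)
    (M : lmodType S) (xs : seq (S * 'I_d)) (P : S -> Prop) : fin_gen_module M ->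
  in_Supp_pp Sg (whole M) (zero M) P -> (forall x, x \in xs -> P x.1) ->
  in_Supp_pp Sg (whole M) (addxN xs (whole M) (zero M)) P.
Proof.
move=> [gs fg] [hP [m0 [_ hm0]]] xsP; split=> //.
have [[[P0 PD PM] [P1 Pprime _]] _] := hP.
apply: contrapT => hn.
have loc m : exists s, ~ P s /\ addxN xs (whole M) (zero M) (s *: m).
  apply: contrapT => h; apply: hn; exists m; split=> // s ns hs; apply: h; by exists s.
have sub v : addxN xs (whole M) (zero M) v -> pspan P gs v.
  case=> l [ms [-> sz _ ->]]; rewrite add0r big_seq; elim/big_ind: _ => [||p pz].
  - exact: pspan0.
  - exact: pspanD.
  - have [cs [szc ->]] := fg p.2; apply: pspan_scale => //; apply: xsP.
    by rewrite -(@unzip1_zip _ _ xs ms) ?sz //; apply: (map_f fst pz).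
have [|t [nt tg]] := @nakayama_elim A S M P PD PM Pprime P1 gs.
  by move=> g _; have [s [ns /sub hs]] := loc g; exists s.
apply: (hm0 t nt); have [cs [sz ->]] := fg m0; rewrite /zero scaler_sumr big_seq big1 // => p pz.
rewrite scalerA mulrC -scalerA tg ?scaler0 //.
by rewrite -(@unzip2_zip _ _ cs gs) ?sz //; apply: (map_f snd pz).
Qed.

Section Symbol.
Context {A : comNzRingType} {S : comAlgType A} {d : nat} {Sg : multideg d -> S -> Prop}.
Context {M : lmodType S} {Mg : multideg d -> M -> Prop}.
Hypotheses (hS : graded_algebra Sg) (hst : standard Sg) (hM : graded_module Sg Mg).
Hypothesis finA : finlen (zero (A^o : lmodType A^o)) (whole _).
Hypotheses (fgS : fin_gen_algebra S) (fgM : fin_gen_module M).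
Local Notation gsub := (@gsub A S d M Mg).
Local Notation hilbz := (@hilbz A S d M Mg).
Implicit Types (L N : M -> Prop) (xs : seq (S * 'I_d)).

Lemma eventually_forall (I : finType) (P : I -> multideg d -> Prop) :
  (forall i, eventually (P i)) -> eventually (fun n => forall i, P i n).
Proof.
move=> h; suff [v hv] : eventually (fun n => forall i, i \in enum I -> P i n).
  by exists v => n vn i; apply: hv; rewrite ?mem_enum.
elim: (enum I) => [|i s IH]; first by exists (Defs.mdeg0 d).
apply: eventually_impl (eventually_and (h i) IH) => n [Pi Ps] j.
by rewrite inE => /orP[/eqP ->|/Ps].
Qed.

Lemma eventually_const (V : zmodType) (f : multideg d -> V) :
  (forall i, eventually (fun n => nabla i f n = 0)) -> exists v, forall n, mle v n -> f n = f v.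
Proof.
move=> /eventually_forall [v hv]; exists v => n vn; rewrite -(mdeg_subK vn).
move: (mdeg_sub n v) => w {n vn}; elim: {w}(mtot w) {-2}w (erefl (mtot w)) => [|k IH] w.
  move/eqP; rewrite sum_nat_eq0 => /forallP w0; congr f; apply/ffunP => i; rewrite ffunE.
  by rewrite (eqP (w0 i)) addn0.
move=> ew; have [i wi] : exists i, (0 < w i)%N.
  apply: contrapT => h; move: ew; rewrite /mtot big1 // => i _.
  by apply/eqP; rewrite -leqn0 leqNgt; apply/negP => wi; apply: h; exists i.
have ui : mle (unitdeg i) w by move=> j; rewrite ffunE; case: eqP => // ->.
have ek : mtot (mdeg_sub w (unitdeg i)) = k.
  apply/eqP; rewrite -eqSS -ew /mtot (bigD1 i) //= [X in _ == X](bigD1 i) //= !ffunE eqxx.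
  rewrite -addSn; apply/eqP; congr (_ + _)%N; first by case: (w i) wi => // m _; rewrite subn1.
  by apply: eq_bigr => j /negbTE ji; rewrite !ffunE ji subn0.
rewrite -(IH _ ek) -{1}(mdeg_subK ui).
set u := mdeg_sub w _; have := hv (mdeg_add v u) (mle_addr _ _) i => /eqP.
by rewrite /nabla subr_eq0 => /eqP <-; rewrite mdeg_addA [mdeg_add v _]mdeg_addC mdeg_addA.
Qed.

(** The absence of such pairs survives the recursion: x_1 kills both N/(L + x_1 N) and (L : x_1)/L,
    so each prime in either support contains x_1, and it lies in the support of N/L. *)
Definition supp_chain_on xs N L := exists P Q : S -> Prop,
  [/\ strict_sub P Q, in_Supp_pp Sg N L P, in_Supp_pp Sg N L Q &
      forall x, x \in xs -> P x.1 /\ Q x.1].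

Lemma etilde_exists xs N L : homog_seq Sg xs -> gsub N -> gsub L -> subP L N ->
  ~ supp_chain_on xs N L ->
  exists c, etilde Mg xs N L c /\ eventually (fun n => nablas (map snd xs) (hilbz N L) n = c).
Proof.
elim: xs N L => [|[x i] xs IH] N L hxs hN hL LN nch.
  have nch1 : ~ supp_chain Sg N L 1.
    by case=> Pc [h1 h2]; apply: nch; exists (Pc 0%N), (Pc 1%N); split=> //; [apply: h2|apply: h1|apply: h1].
  (* Without a chain of length 1 in the support, the first differences in all directions vanish
     eventually. *)
  have [|v hv] := @eventually_const _ (hilbz N L).
    by move=> i; apply: (nablas_hilb_vanish hS hst hM finA fgS fgM (js := [:: i]) hN hL LN nch1).
  exists (hilbz N L v); split; last by exists v.
  apply: etilde_nil; exists v => n vn; have [e] := hv n vn.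
  by rewrite -e; apply: lenP; apply: (finlen_piece hS hst hM finA fgS fgM).
have Sx : Sg (unitdeg i) x by apply: (hxs (x, i)); apply: mem_head.
have hxs' : homog_seq Sg xs by move=> p pxs; apply: hxs; rewrite inE pxs orbT.
have hLx := gsub_addx hM Sx hN hL; have hc := gsub_colon hM Sx hN hL.
have cN : subP (colon x N L) N by move=> v [].
have Lc : subP L (colon x N L) := @sub_colon A S d M Mg x N L hL LN.
have Lx : subP L (addx x N L) := @sub_addx A S d M Mg x N L hN.
have [||a [ha ea]] := IH N (addx x N L) hxs' hN hLx; first exact: (addx_sub hN LN).
  case=> P [Q [PQ hP hQ hx]]; apply: nch; exists P, Q.
  have key R : in_Supp_pp Sg N (addx x N L) R -> in_Supp_pp Sg N L R /\ R x.
    case=> hR [m [Nm hm]]; split.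
      by split=> //; exists m; split=> // s /hm h /Lx.
    apply: contrapT => /hm; apply; exists 0, m; rewrite add0r; split=> //.
    exact: A_submod0 (gsubA hL).
  have [[hP' Px] [hQ' Qx]] := (key P hP, key Q hQ); split=> // y.
  by rewrite inE => /orP[/eqP ->|/hx].
have [|b [hb eb]] := IH (colon x N L) L hxs' hc hL Lc.
  case=> P [Q [PQ hP hQ hx]]; apply: nch; exists P, Q.
  have key R : in_Supp_pp Sg (colon x N L) L R -> in_Supp_pp Sg N L R /\ R x.
    case=> hR [m [[Nm Lm] hm]]; split; first by split=> //; exists m.
    by apply: contrapT => /hm.
  have [[hP' Px] [hQ' Qx]] := (key P hP, key Q hQ); split=> // y.
  by rewrite inE => /orP[/eqP ->|/hx].
exists (a - b); split.
  by apply: (@etilde_cons A S d M Mg (x, i) xs N L a b); first rewrite addxN1.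
apply: eventually_impl (eventually_and (eventually_shift (unitdeg i) ea) eb) => n [<- <-] /=.
rewrite -nablas_shift -nablasB; apply: nablas_ext => m; rewrite /nabla /hilbz.
(* H_{N/L}(m + e_i) and H_{N/L}(m) both contain the term H_{N/(L : x)}(m): the former by
   multiplication with x, the latter by additivity. It cancels in the difference. *)
rewrite (hilb_scale hS hst hM finA fgS fgM m Sx hN hL LN).
rewrite (hilb_add hS hst hM finA fgS fgM m hN hc hL Lc cN) !PoszD.
by rewrite opprD addrA addrAC addrK.
Qed.
End Symbol.

(** * The Koszul complex *)

Section AlternatingSum.
Context {d : nat} {V : zmodType}.

Definition tdeg r (t : r.-tuple 'I_d) (I : {set 'I_r}) : multideg d :=
  [ffun i => (\sum_(j in I) (tnth t j == i))%N].

Lemma lift_setK r (I : {set 'I_r.+1}) :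
  lift ord0 @: [set j | lift ord0 j \in I] = I :\ ord0.
Proof.
apply/setP => j; rewrite !inE; apply/imsetP/andP => [[l] | [j0 jI]].
  by rewrite inE => lI ->; split.
by case: (unliftP ord0 j) j0 jI => [l ->|->] // _ lI; exists l; rewrite ?inE.
Qed.

Lemma mem_lift_set r (I : {set 'I_r}) j : (lift ord0 j \in lift ord0 @: I) = (j \in I).
Proof. by rewrite mem_imset //; apply: lift_inj. Qed.

Lemma ord0_lift_set r (I : {set 'I_r}) : (ord0 \in lift ord0 @: I) = false.
Proof. by apply/imsetP => -[l _ /eqP]; rewrite (negbTE (neq_lift _ _)). Qed.

Lemma sum_set_recl r (F : {set 'I_r.+1} -> V) :
  \sum_(I : {set 'I_r.+1}) F I = \sum_(I : {set 'I_r}) F (lift ord0 @: I) +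
    \sum_(I : {set 'I_r}) F (ord0 |: lift ord0 @: I).
Proof.
pose h' (I : {set 'I_r.+1}) := [set j | lift ord0 j \in I].
have h'K (I : {set 'I_r}) : h' (lift ord0 @: I) = I.
  by apply/setP => j; rewrite inE mem_lift_set.
have h'K1 (I : {set 'I_r}) : h' (ord0 |: lift ord0 @: I) = I.
  by apply/setP => j; rewrite !inE mem_lift_set eq_sym (negbTE (neq_lift _ _)).
rewrite (bigID (fun I : {set 'I_r.+1} => ord0 \notin I)) /=; congr (_ + _).
- rewrite (reindex_onto (fun I : {set 'I_r} => lift ord0 @: I) h') /=; last first.
    by move=> I I0; rewrite lift_setK; apply/setDidPl; rewrite disjoint_sym disjoints1.
  by apply: eq_bigl => I; rewrite ord0_lift_set h'K eqxx.
- rewrite (reindex_onto (fun I : {set 'I_r} => ord0 |: lift ord0 @: I) h') /=; last first.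
    by move=> I; rewrite negbK => I0; rewrite lift_setK setD1K.
  by apply: eq_bigl => I; rewrite !inE eqxx h'K1 eqxx.
Qed.

Lemma tdegC_lift r (x : 'I_d) (t : r.-tuple 'I_d) (I : {set 'I_r}) :
  tdeg [tuple of x :: t] (~: (lift ord0 @: I)) = mdeg_add (unitdeg x) (tdeg t (~: I)).
Proof.
apply/ffunP => i; rewrite !ffunE big_mkcond big_ord_recl !inE ord0_lift_set /= eq_sym.
congr (_ + _)%N; rewrite [RHS]big_mkcond; apply: eq_bigr => j _.
by rewrite !inE mem_lift_set tnthS.
Qed.

Lemma tdegC_lift1 r (x : 'I_d) (t : r.-tuple 'I_d) (I : {set 'I_r}) :
  tdeg [tuple of x :: t] (~: (ord0 |: lift ord0 @: I)) = tdeg t (~: I).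
Proof.
apply/ffunP => i; rewrite !ffunE big_mkcond big_ord_recl !inE eqxx /= add0n.
rewrite [RHS]big_mkcond; apply: eq_bigr => j _.
by rewrite !inE mem_lift_set tnthS eq_sym (negbTE (neq_lift _ _)).
Qed.

(** Expands the product of the operators E_j - 1, with E_j the shift in the direction t_j: I is the
    set of factors contributing -1, its complement gives the shift. *)
Lemma nablas_sum r (t : r.-tuple 'I_d) (f : multideg d -> V) m :
  nablas t f m = \sum_(I : {set 'I_r}) f (mdeg_add m (tdeg t (~: I))) *~ (-1) ^+ #|I|.
Proof.
elim: r t f => [|r IH] t f.
  rewrite tuple0 /= (bigD1 set0) //= big1 ?addr0 => [|I /eqP[]]; last first.
    by apply/setP => -[].
  rewrite cards0 expr0 mulr1z; congr f; apply/ffunP => i.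
  by rewrite !ffunE big_pred0 ?addn0 // => -[].
case: (tupleP t) => x {}t; rewrite /= IH sum_set_recl -big_split /=.
apply: eq_bigr => I _; rewrite tdegC_lift tdegC_lift1 cardsU1 ord0_lift_set add1n.
rewrite card_imset; last exact: lift_inj.
by rewrite exprS mulN1r mulrNz -mulrzBl /nabla !mdeg_addA [mdeg_add m (unitdeg x)]mdeg_addC.
Qed.
End AlternatingSum.

(** * Lengths of finite direct sums *)

Section DirectSum.
Context {A : comNzRingType} {S : comAlgType A} {M : lmodType S} {T : finType}.
Variable G : T -> M -> Prop.
Hypotheses (hG : forall t, A_submod (G t)) (finG : forall t, finlen (zero M) (G t)).

Definition supported (s : seq T) (c : {ffun T -> M}) : Prop :=
  forall t, if t \in s then G t (c t) else c t = 0.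

Lemma supported_submod s : A_submod (supported s).
Proof.
split.
- by move=> t; rewrite ffunE; case: ifP => // _; apply: A_submod0.
- move=> u v hu hv t; rewrite ffunE; case: ifP (hu t) (hv t) => [_|_ -> ->]; last by rewrite addr0.
  exact: A_submodD.
- move=> a v hv t; rewrite ffunE; case: ifP (hv t) => [_|_ ->]; last by rewrite scaler0.
  exact: A_submodZ.
Qed.

Lemma len_supported s : uniq s -> finlen (zero _) (supported s) /\
  len (zero _) (supported s) = (\sum_(t <- s) len (zero M) (G t))%N.
Proof.
elim: s => [_|t s IH /andP[ts us]].
  have -> : supported [::] = zero _.
    apply: predeq => c; split=> [h|-> t]; last by rewrite ffunE.
    by apply/ffunP => t; rewrite ffunE; apply: (h t).
  by rewrite big_nil len_refl; [split=> //; apply: finlen_refl|]; apply: A_submod_zero.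
have [f1 e1] := IH us.
have ss : subP (supported s) (supported (t :: s)).
  move=> c hc u; rewrite inE; case: eqP (hc u) => [->|_ //] /=.
  by rewrite (negbTE ts) => ->; apply: A_submod0.
have fl : finlen (supported s) (supported (t :: s)) /\
    len (supported s) (supported (t :: s)) = len (zero M) (G t); last first.
  by have [f2 e2] := fl; split; [apply: finlen_cat f1 f2|rewrite big_cons (len_add f1 f2) e1 e2 addnC].
have key c : lengthA (supported s) (supported (t :: s)) c <-> lengthA (zero M) (G t) c.
  apply: (@lengthA_map A S S _ _ (fun c : {ffun T -> M} => c t)).
  - by move=> u v; rewrite ffunE.
  - by move=> a v; rewrite ffunE.
  - exact: supported_submod.
  - exact: supported_submod.
  - exact: A_submod_zero.
  - exact: hG.
  - exact: ss.
  - by move=> v ->; apply: A_submod0.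
  - move=> v hv; split=> [/(_ t)|vt u]; first by rewrite (negbTE ts).
    have := hv u; rewrite inE; case: (u =P t) => [->|_ //] _.
    by rewrite (negbTE ts).
  - by move=> v /(_ t); rewrite mem_head.
  - move=> w Gw; exists [ffun u => if u == t then w else 0], 0; rewrite ffunE eqxx addr0; split=> //.
    move=> u; rewrite ffunE inE; case: (u =P t) => [->|_] //=.
    by case: ifP => // _; apply: A_submod0.
have hl := (key _).2 (lenP (finG t)).
by split; [exists (len (zero M) (G t))|exact: len_eq].
Qed.
End DirectSum.

(** Terms are paired off across the diagonal. V may have 2-torsion, so the vanishing of the diagonal
    is a separate hypothesis. *)
Lemma sum_antisym (V : zmodType) r (T : 'I_r -> 'I_r -> V) :
  (forall j, T j j = 0) -> (forall j l, T l j = - T j l) -> \sum_j \sum_l T j l = 0.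
Proof.
move=> T0 TN.
have split_ j : \sum_l T j l = \sum_(l : 'I_r | (j < l)%N) T j l + \sum_(l : 'I_r | (l < j)%N) T j l.
  rewrite (bigID (fun l : 'I_r => (j < l)%N)) /=; congr (_ + _).
  rewrite big_mkcond [RHS]big_mkcond; apply: eq_bigr => l _.
  rewrite -leqNgt; case: (ltngtP l j) => // /val_inj ->; exact: T0.
under eq_bigr do rewrite split_.
rewrite big_split /= [X in _ + X](exchange_big_dep xpredT) //=.
rewrite -big_split big1 // => j _; rewrite -big_split big1 // => l _ /=.
by rewrite [T l j]TN subrr.
Qed.

Section KoszulComplex.
Context {A : comNzRingType} {S : comAlgType A} {d : nat} {Sg : multideg d -> S -> Prop}.
Context {M : lmodType S} {Mg : multideg d -> M -> Prop}.
Hypotheses (hS : graded_algebra Sg) (hst : standard Sg) (hM : graded_module Sg Mg).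
Hypothesis finA : finlen (zero (A^o : lmodType A^o)) (whole _).
Hypotheses (fgS : fin_gen_algebra S) (fgM : fin_gen_module M).
Variable xs : seq (S * 'I_d).
Hypothesis hxs : homog_seq Sg xs.
Local Notation r := (size xs).
Local Notation xt := (in_tuple xs).
Local Notation x j := (tnth xt j).1.
Implicit Types (J : {set 'I_r}) (c : {ffun {set 'I_r} -> M}).

Let sgn J (j : 'I_r) : nat := #|[set l in J | (l < j)%N]|.

Lemma sgn_setU1 J j l : j \notin J -> sgn (j |: J) l = ((j < l) + sgn J l)%N.
Proof.
move=> jJ; rewrite /sgn; have [jl|lj] := ltnP j l.
  have -> : [set k in j |: J | (k < l)%N] = j |: [set k in J | (k < l)%N].
    by apply/setP => k; rewrite !inE andb_orl; case: eqP => // ->; rewrite jl.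
  by rewrite cardsU1 inE (negbTE jJ).
rewrite add0n; apply: eq_card => k; rewrite !inE andb_orl.
by case: eqP => // ->; rewrite ltnNge lj (negbTE jJ).
Qed.

Lemma kdiffE c J : kdiff c J =
  \sum_(j | j \notin J) ((-1) ^+ sgn J j * x j) *: c (j |: J).
Proof. by rewrite ffunE. Qed.

(** Adjoining j and l to J in either order reaches the same component of c. The two sign exponents
    differ by one, since exactly one of j < l and l < j holds. *)
Lemma kdiffK c : kdiff (kdiff c) = 0.
Proof.
apply/ffunP => J; rewrite kdiffE [RHS]ffunE.
pose T (j l : 'I_r) : M := if [&& j \notin J, l \notin J & j != l] then
  ((-1) ^+ (sgn J j + (j < l) + sgn J l) * (x j * x l)) *: c (j |: (l |: J)) else 0.
rewrite -[RHS](@sum_antisym M r T).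
- rewrite big_mkcond; apply: eq_bigr => j _.
  case: ifP => [jJ|nJ]; last by rewrite big1 // => l _; rewrite /T nJ.
  rewrite kdiffE scaler_sumr big_mkcond; apply: eq_bigr => l _.
  rewrite /T jJ !inE negb_or eq_sym andbC; case: ifP => // _.
  by rewrite scalerA sgn_setU1 // setUCA mulrACA -!exprD addnA.
- by move=> j; rewrite /T eqxx !andbF.
- move=> j l; rewrite /T andbCA eq_sym; case: ifP => [/and3P[_ _ jl]|_]; last by rewrite oppr0.
  rewrite -scaleNr setUCA [x l * _]mulrC -mulNr; congr ((_ * _) *: _).
  have {jl} jl : (j < l)%N = ~~ (l < j)%N.
    by rewrite -leqNgt ltn_neqAle jl.
  rewrite jl [(sgn J l + _ + _)%N]addnAC -addnA -[in RHS]addnAC [in RHS]exprD [in LHS]addnA exprD.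
  rewrite [(sgn J l + _)%N]addnC -mulrN; congr (_ * _).
  by case: (l < j)%N; rewrite ?expr0 ?expr1 ?opprK.
Qed.

Lemma kdiffD : {morph (@kdiff A S d M xs) : u v / u + v}.
Proof.
move=> u v; apply/ffunP => J; rewrite [RHS]ffunE !kdiffE -big_split.
by apply: eq_bigr => j _; rewrite ffunE scalerDr.
Qed.

Lemma kdiffZ (a : S) v : kdiff (a *: v) = a *: kdiff v :> {ffun {set 'I_r} -> M}.
Proof.
apply/ffunP => J; rewrite [RHS]ffunE !kdiffE scaler_sumr.
by apply: eq_bigr => j _; rewrite ffunE !scalerA mulrC.
Qed.

Lemma kdiff0 : kdiff 0 = 0 :> {ffun {set 'I_r} -> M}.
Proof. by rewrite -(scale0r 0) kdiffZ !scale0r. Qed.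

Variable n : multideg d.
(** For such n no summand of the complex is cut off, and n - degI J is a true subtraction. *)
Hypothesis hn : forall J, mle (degI J) n.

Local Notation K i := (@Kpiece A S d M Mg xs i n).
Local Notation Z i := (@kcycles A S d M Mg xs i n).
Local Notation B i := (@kbounds A S d M Mg xs i n).

Lemma KpieceE i : K i =
  supported (fun J => Mg (mdeg_sub n (degI J))) (enum [pred J : {set 'I_r} | #|J| == i]).
Proof.
apply: predeq => c; split=> h J; have := h J; rewrite mem_enum inE; case: ifP => // _.
  by have -> : [forall l, (degI J l <= n l)%N] by apply/forallP/hn.
by have -> : [forall l, (degI J l <= n l)%N] by apply/forallP/hn.
Qed.

Let Mg_submod m : A_submod (Mg m). Proof. by case: hM. Qed.
Let fin_Mg m : finlen (zero M) (Mg m). Proof. exact: finlen_zero_piece hS hst hM finA fgS fgM m. Qed.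

Lemma K_submod i : A_submod (K i).
Proof. by rewrite KpieceE; apply: supported_submod. Qed.

Lemma K_finlen i : finlen (zero _) (K i).
Proof. by rewrite KpieceE; apply: (len_supported _ _ _).1 => //; apply: enum_uniq. Qed.

Lemma K_len i : len (zero _) (K i) =
  (\sum_(J : {set 'I_r} | #|J| == i) len (zero M) (Mg (mdeg_sub n (degI J))))%N.
Proof.
rewrite KpieceE (len_supported _ _ _).2 //; first by rewrite big_enum.
exact: enum_uniq.
Qed.

Lemma degI_setU1 J j : j \notin J -> degI (j |: J) = mdeg_add (unitdeg (tnth xt j).2) (degI J).
Proof.
move=> jJ; apply/ffunP => i; rewrite !ffunE.
have -> : [set l in j |: J | (tnth xt l).2 == i] =
    if (tnth xt j).2 == i then j |: [set l in J | (tnth xt l).2 == i] else [set l in J | (tnth xt l).2 == i].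
  apply/setP => l; rewrite !inE andb_orl; case: (l =P j) => [->|/eqP lj] /=.
    by case: ifP; rewrite !inE ?eqxx //= (negbTE jJ) => ->.
  by case: ifP; rewrite !inE // (negbTE lj).
rewrite eq_sym; case: eqP => [_|_]; last by rewrite add0n.
by rewrite cardsU1 inE (negbTE jJ).
Qed.

Lemma kdiff_K i c : K i.+1 c -> K i (kdiff c).
Proof.
rewrite !KpieceE => hc J; have [_ MM _] := hM; rewrite mem_enum inE.
have cJ j : j \notin J -> #|j |: J| = #|J|.+1 by move=> jJ; rewrite cardsU1 jJ.
case: eqP => eJ; rewrite kdiffE; last first.
  rewrite big1 // => j jJ; have := hc (j |: J); rewrite mem_enum inE cJ // eqSS.
  by move/eqP/negbTE: eJ => -> ->; rewrite scaler0.
apply: A_submod_sum => // j jJ.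
have := hc (j |: J); rewrite mem_enum inE cJ // eqSS eJ eqxx => hj.
have e : mdeg_sub n (degI J) = mdeg_add (unitdeg (tnth xt j).2) (mdeg_sub n (degI (j |: J))).
  apply/ffunP => k; have := hn (j |: J) k; rewrite degI_setU1 // !ffunE.
  by set u := nat_of_bool _; lia.
have Sx : Sg (unitdeg (tnth xt j).2) (x j) by apply/hxs/mem_tnth.
rewrite e -scalerA -signr_odd; case: (odd _); rewrite ?expr0 ?expr1 ?scale1r ?scaleN1r.
  by apply: A_submodN => //; apply: MM.
exact: MM.
Qed.

Lemma Z_submod i : A_submod (Z i).
Proof.
have hK := K_submod i; split.
- by split; [exact: (A_submod0 hK)|exact: kdiff0].
- by move=> u v [? eu] [? ev]; split; [apply: (A_submodD hK) => //|rewrite kdiffD eu ev addr0].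
- by move=> a v [? ev]; split; [apply: (A_submodZ _ hK) => //|rewrite kdiffZ ev scaler0].
Qed.

Lemma B_submod i : A_submod (B i).
Proof.
have hK := K_submod i.+1; split.
- by exists 0; split; [exact: (A_submod0 hK)|rewrite kdiff0].
- by move=> _ _ [u [Ku ->]] [v [Kv ->]]; exists (u + v); split; [apply: (A_submodD hK) => //|rewrite kdiffD].
- by move=> a _ [v [Kv ->]]; exists (a%:A *: v); split; [apply: (A_submodZ _ hK) => //|rewrite kdiffZ].
Qed.

Lemma BZ i : subP (B i) (Z i).
Proof. by move=> _ [c [Kc ->]]; split; [exact: kdiff_K|exact: kdiffK]. Qed.

Lemma Z_finlen i : finlen (zero _) (Z i) /\ finlen (Z i) (K i).
Proof.
apply: finlen_split (K_finlen i) (Z_submod i) _ _ => [v ->|v []//].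
exact: A_submod0 (Z_submod i).
Qed.

Lemma B_finlen i : finlen (zero _) (B i) /\ finlen (B i) (Z i).
Proof.
apply: finlen_split (Z_finlen i).1 (B_submod i) _ (@BZ i) => v ->.
exact: A_submod0 (B_submod i).
Qed.

Lemma K0_cycles : K 0 = Z 0.
Proof.
apply: predeq => c; split=> [Kc|[]//]; split=> //; apply/ffunP => J.
rewrite kdiffE ffunE big1 // => j jJ; move: Kc; rewrite KpieceE => /(_ (j |: J)).
by rewrite mem_enum inE cardsU1 jJ add1n => ->; rewrite scaler0.
Qed.

Lemma len_KZB i : len (zero _) (K i.+1) = (len (zero _) (Z i.+1) + len (zero _) (B i))%N.
Proof.
rewrite (len_add (Z_finlen i.+1).1 (Z_finlen i.+1).2); congr (_ + _)%N.
apply: (@len_map A S S _ _ (@kdiff A S d M xs)).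
- exact: kdiffD.
- by move=> a v; apply: kdiffZ.
- exact: Z_submod.
- exact: K_submod.
- exact: A_submod_zero.
- exact: B_submod.
- by move=> v [].
- by move=> v ->; apply: A_submod0 (B_submod i).
- by move=> v Kv; split=> [[]|].
- by move=> v Kv; exists v.
- by move=> _ [v [Kv ->]]; exists v, 0; rewrite addr0.
- exact: (Z_finlen i.+1).2.
Qed.

Lemma B_last : len (zero _) (B r) = 0%N.
Proof.
have -> : B r = zero _; last exact/len_refl/A_submod_zero.
apply: predeq => c; split=> [[c' [Kc' ->]]|->]; last exact: A_submod0 (B_submod r).
have -> : c' = 0; last exact: kdiff0.
apply/ffunP => J; rewrite ffunE; move: Kc'; rewrite KpieceE => /(_ J).
by rewrite mem_enum inE ltn_eqF // ltnS -[X in (_ <= X)%N]card_ord max_card.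
Qed.

Lemma koszul_euler_char : exists h : nat -> nat,
  (forall i, (i <= r)%N -> lengthA (B i) (Z i) (h i)) /\
  \sum_(i < r.+1) (-1) ^+ i * (h i)%:Z =
    \sum_(J : {set 'I_r}) (len (zero M) (Mg (mdeg_sub n (degI J))))%:Z * (-1) ^+ #|J|.
Proof.
exists (fun i => len (B i) (Z i)); split; first by move=> i _; apply/lenP/(B_finlen i).2.
pose k i : int := (len (zero _) (K i))%:Z.
(* The boundaries telescope: up to m only the length of [B m] is left over, and it vanishes at m = r
   because K_{r+1} = 0. *)
have step m : \sum_(i < m.+1) (-1) ^+ i * (len (B i) (Z i))%:Z =
    \sum_(i < m.+1) (-1) ^+ i * k i - (-1) ^+ m * (len (zero _) (B m))%:Z.
  have lz i : (len (B i) (Z i))%:Z = (len (zero _) (Z i))%:Z - (len (zero _) (B i))%:Z.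
    by rewrite (len_add (B_finlen i).1 (B_finlen i).2) PoszD addrC addKr.
  elim: m => [|m IH].
    by rewrite !big_ord1 /= !expr0 !mul1r lz /k K0_cycles.
  rewrite big_ord_recr [in RHS]big_ord_recr /= IH lz /k len_KZB PoszD exprS mulN1r.
  by rewrite !mulNr !mulrBr !mulrDr !opprD !opprK !addrA; congr (_ + _); rewrite addrAC.
rewrite step B_last mulr0 subr0.
under eq_bigr => i _ do rewrite /k K_len (big_morph Posz PoszD (erefl (Posz 0))) mulr_sumr.
rewrite (exchange_big_dep xpredT) //=; apply: eq_bigr => J _.
have cJ : (#|J| < r.+1)%N by rewrite ltnS -[X in (_ <= X)%N]card_ord max_card.
by rewrite (big_pred1 (Ordinal cJ)) 1?mulrC // => i; rewrite /= -val_eqE /= eq_sym.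
Qed.
End KoszulComplex.

(** * Polynomials and iterated differences *)

Section PolynomialDifferences.

Definition fdiff (f : nat -> rat) : nat -> rat := fun x => f x.+1 - f x.

Lemma iter_fdiff_sum k n (a : 'I_n -> rat) (f : 'I_n -> nat -> rat) x :
  iter k fdiff (fun x => \sum_j a j * f j x) x = \sum_j a j * iter k fdiff (f j) x.
Proof.
elim: k x => [//|k IH] x; rewrite iterS /fdiff !IH -sumrB.
by apply: eq_bigr => j _; rewrite -mulrBr.
Qed.

Lemma fdiff_exp a : fdiff (fun x => x%:R ^+ a) = fun x => \sum_(j < a) ('C(a, j))%:R * x%:R ^+ j.
Proof.
apply: funext => x; rewrite /fdiff -natr1 [x%:R + 1]addrC exprDn big_ord_recr /=.
rewrite binn subnn expr0 mul1r mulr1n addrK.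
by apply: eq_bigr => j _; rewrite expr1n mul1r mulr_natl.
Qed.

Lemma iter_fdiff_exp k a x : (a <= k)%N ->
  iter k fdiff (fun x => x%:R ^+ a) x = if a == k then (k`!)%:R else 0.
Proof.
elim: k a x => [|k IH] a x ak.
  by move: ak; rewrite leqn0 => /eqP ->; rewrite /= expr0.
rewrite iterSr fdiff_exp iter_fdiff_sum; case: eqP => [->|/eqP ne].
  rewrite big_ord_recr /= big1 ?add0r => [|j _]; last by rewrite IH ?(ltnW (ltn_ord j)) // ltn_eqF ?mulr0.
  by rewrite IH // eqxx binSn factS natrM.
rewrite big1 // => j _; have ja : (j < k)%N.
  by apply: leq_trans (ltn_ord j) _; move: ak; rewrite leq_eqVlt (negbTE ne).
by rewrite IH ?(ltnW ja) // ltn_eqF ?mulr0.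
Qed.

Context {d : nat}.
Implicit Types (js : seq 'I_d) (P : {mpoly rat[d]}).

Lemma nablas_prod js (g : 'I_d -> nat -> rat) (n : multideg d) :
  nablas js (fun n : multideg d => \prod_l g l (n l)) n =
  \prod_l iter (count_mem l js) fdiff (g l) (n l).
Proof.
elim: js g => [//|i js IH] g /=.
have -> : nabla i (fun n : multideg d => \prod_l g l (n l)) =
    (fun n : multideg d => \prod_l (if l == i then fdiff (g l) else g l) (n l)).
  apply: funext => m; rewrite /nabla (bigD1 i) //= [X in _ - X](bigD1 i) //= [RHS](bigD1 i) //=.
  rewrite eqxx /fdiff mulrBl !ffunE eqxx add1n; congr (_ * _ - _ * _); apply: eq_bigr => l /negbTE li.
    by rewrite !ffunE li.
  by rewrite li.
rewrite (IH (fun l => if l == i then fdiff (g l) else g l)); apply: eq_bigr => l _.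
rewrite [i == l]eq_sym; case: eqP => [->|_] //.
by rewrite add1n iterSr.
Qed.

Lemma nablas_lin js (I : Type) (s : seq I) (a : I -> rat) (f : I -> multideg d -> rat) n :
  nablas js (fun n => \sum_(i <- s) a i * f i n) n = \sum_(i <- s) a i * nablas js (f i) n.
Proof.
elim: js f n => [//|j js IH] f n /=; rewrite -IH; apply: nablas_ext => m.
by rewrite /nabla -sumrB; apply: eq_bigr => i _; rewrite mulrBr.
Qed.

Lemma size_sum_count js : size js = (\sum_i count_mem i js)%N.
Proof.
elim: js => [|j js IH] /=; first by rewrite big1.
rewrite big_split /= -IH (bigD1 j) //= eqxx big1 // => i /negbTE; by rewrite eq_sym => ->.
Qed.

(** A monomial m' other than m of degree at most |m| has m'_l < m_l for some l, so the differences
    in direction l kill it; m itself yields m!. As [msize] is the degree plus one, the bound says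
    that deg P <= |m|. *)
Lemma nablas_poly js P (m : 'X_{1..d}) n : (forall i, m i = count_mem i js) ->
  (msize P <= (size js).+1)%N ->
  nablas js (fun n : multideg d => P.@[fun i => (n i)%:R]) n = (\prod_(i < d) (m i)`!)%N%:R * P@_m.
Proof.
move=> mj szP.
rewrite (@nablas_ext _ _ _ _ (fun n : multideg d =>
  \sum_(m' <- msupp P) P@_m' * \prod_l (n l)%:R ^+ m' l)); last by move=> u; rewrite mevalE.
rewrite nablas_lin.
have term (m' : 'X_{1..d}) : m' \in msupp P ->
    nablas js (fun n : multideg d => \prod_l (n l)%:R ^+ m' l) n =
    (if m' == m then (\prod_(i < d) (m i)`!)%N%:R else 0) :> rat.
  move=> /msize_mdeg_lt hm; rewrite (nablas_prod js (fun l x => x%:R ^+ m' l)).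
  case: eqP => [->|ne].
    by rewrite natr_prod; apply: eq_bigr => l _; rewrite iter_fdiff_exp mj // eqxx.
  have [l hl] : exists l, (m' l < m l)%N.
    apply: contrapT => h; apply: ne.
    have mm' l : (m l <= m' l)%N by rewrite leqNgt; apply/negP => hl; apply: h; exists l.
    apply/mnmP => l; apply/eqP; rewrite eqn_leq mm' andbT leqNgt; apply/negP => hl.
    suff : (size js < mdeg m')%N by move=> h2; have := leq_trans hm szP; lia.
    rewrite size_sum_count mdegE (bigD1 l) //= [X in (_ < X)%N](bigD1 l) //= -addSn.
    by apply: leq_add; [rewrite -mj|apply: leq_sum => i _; rewrite -mj].
  rewrite (bigD1 l) //= iter_fdiff_exp -mj ?(ltnW hl) // ltn_eqF // mul0r //.
under eq_big_seq do rewrite term //.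
have [mP|mP] := boolP (m \in msupp P).
  rewrite (bigD1_seq m) ?msupp_uniq //= eqxx [X in _ + X]big1 ?addr0 1?mulrC // => m' /negbTE ->.
  by rewrite mulr0.
rewrite (memN_msupp_eq0 mP) mulr0 big_seq big1 // => m' m'P.
by case: eqP => [e|]; [rewrite -e m'P in mP|rewrite mulr0].
Qed.

Lemma exists_type (m : 'X_{1..d}) : exists js, (forall i, count_mem i js = m i) /\ size js = mdeg m.
Proof.
suff [js hjs] : exists js, forall i, count_mem i js = m i.
  by exists js; split=> //; rewrite size_sum_count mdegE; apply: eq_bigr.
exists (flatten [seq nseq (m i) i | i <- enum 'I_d]) => i.
rewrite count_flatten -map_comp sumnE big_map big_enum /= (bigD1 i) //= count_nseq /= eqxx mul1n.
by rewrite big1 ?addn0 // => j /negbTE ji; rewrite count_nseq /= ji.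
Qed.

(** If deg P >= t, differences of the type of the leading monomial m begin with t of them that kill
    P eventually, yet all together they give m! times the leading coefficient, a nonzero
    constant. *)
Lemma msize_nablas P t : (forall js, size js = t ->
    eventually (fun n => nablas js (fun n : multideg d => P.@[fun i => (n i)%:R]) n = 0)) ->
  (msize P <= t)%N.
Proof.
move=> h; rewrite leqNgt; apply/negP => tP.
have P0 : P != 0 by apply/negP => /eqP e; rewrite e msize0 in tP.
have [js [hjs sz]] := exists_type (mlead P).
have szP : msize P = (size js).+1 by rewrite sz mlead_deg.
have tj : (t <= size js)%N by rewrite -ltnS -szP.
have /(nablas_eventually0 (drop t js)) := h (take t js) (size_takel tj).
case/eventually_ex => n; rewrite -nablas_cat cat_take_drop.
rewrite (@nablas_poly js P (mlead P)) ?szP // => /eqP.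
rewrite mulf_eq0 mleadc_eq0 (negbTE P0) orbF Num.Theory.pnatr_eq0 => /eqP.
by apply/eqP; rewrite -lt0n prodn_gt0 // => i; apply: fact_gt0.
Qed.

Lemma nablas_intr js (f : multideg d -> int) n :
  nablas js (fun n => (f n)%:~R : rat) n = (nablas js f n)%:~R.
Proof. by elim: js f => //= i js IH f; rewrite -IH; apply: nablas_ext => m; rewrite /nabla rmorphB. Qed.
End PolynomialDifferences.

(** Given dim <= |k|, a chain of length |k| in the support means dim = |k|, where E(M;k) is the
    mixed multiplicity; without one, dim < |k| and E(M;k) = 0. This is the case distinction made for
    each Hilbert polynomial P. *)
Theorem theorem3p12 (A : comNzRingType) (S : comAlgType A) (d : nat)
  (Sg : multideg d -> S -> Prop) (M : lmodType S) (Mg : multideg d -> M -> Prop)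
  (k : multideg d) (xs : seq (S * 'I_d)) :
  local_ring A -> artinian_ring A -> infinite_residue_field A ->
  graded_algebra Sg -> standard Sg -> fin_gen_algebra S ->
  graded_module Sg Mg -> fin_gen_module M ->
  mm_system Sg xs k (whole M) (zero M) ->
  dim_supp_le Sg (whole M) (zero M) (mtot k) ->
  exists c : int,
    [/\ euler_char Mg xs c,
        etilde Mg xs (whole M) (zero M) c &
        forall P : {mpoly rat[d]}, hilbert_poly Mg P ->
          (supp_chain Sg (whole M) (zero M) (mtot k) -> mixed_coef P k = c%:~R) /\
          (~ supp_chain Sg (whole M) (zero M) (mtot k) -> c = 0)].
Proof.
move=> _ artA _ hS hst fgS hM fgM [hxs htype hdim] hdimk.
have finA := artinian_finlen artA.
have gW : @gsub A S d M Mg (whole M) by [].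
have g0 : @gsub A S d M Mg (zero M) := gsub_zero hM.
have zW : subP (zero M) (whole M) by [].
pose js := map snd xs; pose H := @hilbz A S d M Mg (whole M) (zero M).
have HE n : H n = (len (zero M) (Mg n))%:Z.
  rewrite /H /hilbz /hilb; congr (Posz (len _ _)); apply: predeq => v; split=> [[]|] //.
    by move=> ->; split=> //; apply: A_submod0; case: hM.
have [|c [hc ec]] := etilde_exists hS hst hM finA fgS fgM hxs gW g0 zW.
  (* Both primes contain x, so they lie in the support of M/xM and form a chain of length 1 there,
     against dim <= 0. *)
  case=> P [Q [PQ hP hQ hx]]; apply: hdim; exists (fun i => if i is 0%N then P else Q); split.
    by case=> [|i] _; apply: Supp_quotient => // x /hx[].
  by case=> // i; rewrite ltnS.
have cnt i : count_mem i js = k i by rewrite /js count_map -htype.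
have szk : size js = mtot k by rewrite size_sum_count; apply: eq_bigr.
have vanish js' t : ~ supp_chain Sg (whole M) (zero M) t -> size js' = t ->
    eventually (fun n => nablas js' H n = 0).
  exact: (nablas_hilb_vanish hS hst hM finA fgS fgM gW g0 zW).
exists c; split=> //.
- pose t := map_tuple snd (in_tuple xs).
  have degE J : @degI A S d xs J = tdeg t J.
    apply/ffunP => i; rewrite !ffunE -sum1_card [RHS]big_mkcond [LHS]big_mkcond.
    by apply: eq_bigr => j _; rewrite inE tnth_map; case: (j \in J); case: eqP.
  (* [tdeg t setT] equals k. The Koszul complex in degree n uses M in degrees n - degI J, so its
     Euler characteristic is the difference of H at n - k, which has to lie above v. *)
  have [v hv] := ec; exists (mdeg_add v (tdeg t setT)) => n vn.
  have tn : mle (tdeg t setT) n by apply: mle_trans vn; apply: mle_addl.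
  have tC J : mdeg_add (tdeg t J) (tdeg t (~: J)) = tdeg t setT.
    apply/ffunP => i; rewrite !ffunE [RHS](bigID (mem J)) /=.
    by congr (_ + _)%N; apply: eq_bigl => j; rewrite !inE.
  have hn J : mle (@degI A S d xs J) n.
    by rewrite degE; apply: mle_trans tn; rewrite -(tC J); apply: mle_addr.
  have [h [hl hs]] := koszul_euler_char hS hst hM finA fgS fgM hxs hn.
  exists h; split=> //; rewrite hs.
  pose u := mdeg_sub n (tdeg t setT).
  have un : n = mdeg_add u (tdeg t setT) by rewrite mdeg_addC mdeg_subK.
  have vu : mle v u by move=> i; have := vn i; rewrite !ffunE; lia.
  rewrite -(hv u vu) -[map snd xs]/(tval t) nablas_sum; apply: eq_bigr => J _.
  rewrite -/H HE mulrzz; congr (Posz (len _ (Mg _)) * _).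
  by rewrite un -(tC J) degE mdeg_addA [mdeg_add u _]mdeg_addC -mdeg_addA mdeg_addK.
- move=> P [v hv]; split=> [_|nch]; last first.
    by have [n [e1 e2]] := eventually_ex (eventually_and ec (vanish js _ nch szk)); rewrite -e1.
  have PH js' n : mle v n ->
      nablas js' (fun n : multideg d => P.@[fun i => (n i)%:R]) n = (nablas js' H n)%:~R.
    move=> vn; rewrite -nablas_intr; apply: nablas_local vn => m vm.
    by have [e [/len_eq le ->]] := hv m vm; rewrite HE le.
  (* There is no chain of length |k| + 1, so all differences of that order vanish eventually and deg
     P <= |k|. *)
  have szP : (msize P <= (size js).+1)%N.
    apply: msize_nablas => js' sz; have [w hw] := vanish js' _ hdimk (etrans sz (congr1 succn szk)).
    exists (mdeg_add v w) => n vwn; rewrite PH ?hw //.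
      exact: mle_trans (mle_addl _ _) vwn.
    exact: mle_trans (mle_addr _ _) vwn.
  have [n [vn e]] := eventually_ex (eventually_and (ex_intro _ v (fun n vn => vn)) ec).
  rewrite /mixed_coef -e -PH // (nablas_poly (m := [multinom k i | i < d])) //.
    by congr (_%:R * _); apply: eq_bigr => i _; rewrite mnmE.
  by move=> i; rewrite mnmE cnt.
Qed.
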